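(* Let $n\ge 1$ and let $\equiv$ be any catalan congruence of the lattice $\mathbf{ASM}_n$ of alternating sign matrices of order $n$. Then: (i) the maximal alternating sign matrix of each congruence class of $\equiv$ is the permutation matrix $P_\sigma$ of a covexillary permutation $\sigma\in\mathfrak{S}_n$; (ii) the minimal permutation matrices in the congruence classes of $\equiv$ are precisely the $321$-avoiding permutation matrices; that is, a permutation $\sigma\in\mathfrak{S}_n$ is such that $P_\sigma$ is minimal (for the order of $\mathbf{ASM}_n$) among the permutation matrices contained in its congruence class if and only if $\sigma$ avoids the pattern $321$; (iii) any choice of representative permutation matrices, one in each congruence class of $\equiv$, yields a basis of the Temperley--Lieb algebra $\mathrm{TL}_n(2)$; that is, if $R\subseteq\mathfrak{S}_n$ contains exactly one permutation $\sigma$ with $P_\sigma\in X$ for each congruence class $X$ of $\equiv$, then the images of the elements of $R$ in $\mathrm{TL}_n(2)$ form a $\mathbb{C}$-basis of $\mathrm{TL}_n(2)$.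
   Context: An alternating sign matrix (ASM) of order $n$ is an $n\times n$ matrix $A$ with entries in $\{-1,0,1\}$, all row and column sums equal to $1$, and whose nonzero entries alternate between $1$ and $-1$ along each row and each column. Its height function matrix (HFM) is the matrix $H$ with $H_{i,j}=i+j-2\sum_{i'\le i,\,j'\le j}A_{i',j'}$ for $0\le i,j\le n$. The set $\mathbf{ASM}_n$ of ASMs of order $n$ is ordered by $A\le A'$ iff the corresponding HFMs satisfy $H_{i,j}\le H'_{i,j}$ for all $i,j$; this is a distributive lattice. The permutation matrix of $\sigma\in\mathfrak{S}_n$ is $P_\sigma=[\delta_{\sigma(i),j}]_{i,j\in[n]}$, which is an ASM. A congruence of a lattice is an equivalence relation $\equiv$ such that $x\equiv x'$ and $y\equiv y'$ imply $x\vee y\equiv x'\vee y'$ and $x\wedge y\equiv x'\wedge y'$; the set of classes is then a lattice (the quotient) with the operations induced on representatives, and classes are intervals. $\mathbf{Dyck}_n$ (the Stanley lattice) is the set of Dyck paths of semilength $n$ (paths with steps $(1,1)$ and $(1,-1)$ from $(0,0)$ to $(2n,0)$ never going strictly below the horizontal axis), ordered by $P\le Q$ iff $P$ stays (weakly) below $Q$. A catalan congruence is a congruence of the lattice $\mathbf{ASM}_n$ whose quotient is isomorphic to $\mathbf{Dyck}_n$. A permutation is covexillary if it avoids the pattern $3412$. $\mathrm{TL}_n(2)$ is the Temperley--Lieb algebra with parameter $2$, realized as the quotient $\mathbb{C}\mathfrak{S}_n/\langle ()-(ij)-(jk)-(ik)+(ijk)+(ikj) \mid 1\le i<j<k\le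 n\rangle$ of the group algebra by the indicated two-sided ideal (permutations in cycle notation); the image of a permutation in $\mathrm{TL}_n(2)$ is its class in this quotient. *)

(* Defs.v *)
From HB Require Import structures.
From mathcomp Require Import all_boot all_order all_algebra all_fingroup all_field.
From mathcomp Require Import zify.

Set Implicit Arguments.
Unset Strict Implicit.
Unset Printing Implicit Defensive.

Import Order.TTheory GRing.Theory Num.Theory.
Local Open Scope ring_scope.

Record congruence d (L : latticeType d) := Congruence {
  congr_rel :> rel L;
  congr_refl : reflexive congr_rel;
  congr_sym : symmetric congr_rel;
  congr_trans : transitive congr_rel;
  congr_joins : forall x x' y y', congr_rel x x' -> congr_rel y y' ->
    congr_rel (Order.join x y) (Order.join x' y');
  congr_meets : forall x x' y y', congr_rel x x' -> congr_rel y y' ->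
    congr_rel (Order.meet x y) (Order.meet x' y')
}.

Section QuotientLattice.
Local Open Scope quotient_scope.
Variables (d : Order.disp_t) (L : latticeType d) (c : congruence L).

(* [repr] would otherwise be the coset representative of fingroup. *)
Local Notation repr := (generic_quotient.repr).

Definition congr_equiv : equiv_rel L :=
  EquivRel c (congr_refl c) (congr_sym c) (congr_trans (c := c)).

Definition congr_quot : Type := {eq_quot congr_equiv}.
HB.instance Definition _ := Choice.on congr_quot.
HB.instance Definition _ := EqQuotient.on congr_quot.

Definition class_of (x : L) : congr_quot := \pi_congr_quot x.

Lemma class_ofP x y : reflect (class_of x = class_of y) (c x y).
Proof. exact: (@eqmodP L congr_equiv x y). Qed.

Lemma class_of_repr X : class_of (repr X) = X.
Proof. exact: reprK. Qed.

Definition quot_meet (X Y : congr_quot) := class_of (Order.meet (repr X) (repr Y)).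
Definition quot_join (X Y : congr_quot) := class_of (Order.join (repr X) (repr Y)).

Lemma quot_meetE x y :
  quot_meet (class_of x) (class_of y) = class_of (Order.meet x y).
Proof. by apply/class_ofP/congr_meets; apply/class_ofP/class_of_repr. Qed.

Lemma quot_joinE x y :
  quot_join (class_of x) (class_of y) = class_of (Order.join x y).
Proof. by apply/class_ofP/congr_joins; apply/class_ofP/class_of_repr. Qed.

Definition quot_le (X Y : congr_quot) := quot_meet X Y == X.

Lemma quot_meetC : commutative quot_meet.
Proof.
by move=> X Y; rewrite -[X]class_of_repr -[Y]class_of_repr !quot_meetE meetC.
Qed.
Lemma quot_joinC : commutative quot_join.
Proof.
by move=> X Y; rewrite -[X]class_of_repr -[Y]class_of_repr !quot_joinE joinC.
Qed.
Lemma quot_meetA : associative quot_meet.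
Proof.
move=> X Y Z; rewrite -[X]class_of_repr -[Y]class_of_repr -[Z]class_of_repr.
by rewrite !quot_meetE meetA.
Qed.
Lemma quot_joinA : associative quot_join.
Proof.
move=> X Y Z; rewrite -[X]class_of_repr -[Y]class_of_repr -[Z]class_of_repr.
by rewrite !quot_joinE joinA.
Qed.
Lemma quot_joinKI Y X : quot_meet X (quot_join X Y) = X.
Proof.
rewrite -[X]class_of_repr -[Y]class_of_repr quot_joinE quot_meetE.
by rewrite joinKI.
Qed.
Lemma quot_meetKU Y X : quot_join X (quot_meet X Y) = X.
Proof.
rewrite -[X]class_of_repr -[Y]class_of_repr quot_meetE quot_joinE.
by rewrite meetKU.
Qed.

Lemma quot_le_refl : reflexive quot_le.
Proof. by move=> X; rewrite /quot_le -[X]class_of_repr quot_meetE meetxx. Qed.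
Lemma quot_le_anti : antisymmetric quot_le.
Proof. by move=> X Y /andP[/eqP eX /eqP eY]; rewrite -eX quot_meetC. Qed.
Lemma quot_le_trans : transitive quot_le.
Proof.
by move=> Y X Z /eqP XY /eqP YZ; apply/eqP; rewrite -XY -quot_meetA YZ.
Qed.

HB.instance Definition _ := Order.Le_isPOrder.Build d congr_quot
  quot_le_refl quot_le_anti quot_le_trans.
HB.instance Definition _ := Order.POrder_isLattice.Build d congr_quot
  quot_meetC quot_joinC quot_meetA quot_joinA quot_joinKI quot_meetKU
  (fun X Y => erefl).

End QuotientLattice.

Definition alternating m (v : 'I_m -> int) : bool :=
  [forall j : 'I_m, forall k : 'I_m,
    [&& (j < k)%N, v j != 0, v k != 0 &
        [forall l : 'I_m, (j < l < k)%N ==> (v l == 0)]]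
    ==> (v k == - v j)].

Definition is_asm n (A : 'M[int]_n) : bool :=
  [&& [forall i, forall j, A i j \in [:: -1; 0; 1]],
      [forall i, \sum_j A i j == 1],
      [forall j, \sum_i A i j == 1],
      [forall i, alternating (fun j => A i j)] &
      [forall j, alternating (fun i => A i j)]].

Record asm n := Asm { asm_mx :> 'M[int]_n; _ : is_asm asm_mx }.

HB.instance Definition _ n := [isSub for @asm_mx n].
HB.instance Definition _ n := [Choice of asm n by <:].

(* Rows and columns are 0-based, hence the strict inequalities. *)
Definition corner n (A : 'M[int]_n) (i j : nat) : int :=
  \sum_(i' < n | (i' < i)%N) \sum_(j' < n | (j' < j)%N) A i' j'.

Definition hfm n (A : 'M[int]_n) : 'M[int]_n.+1 :=
  \matrix_(i, j) ((i + j)%:Z - 2 * corner A i j).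

Definition asm_le n (A B : asm n) : bool :=
  [forall i, forall j, hfm A i j <= hfm B i j].

Section AlternatingSums.
Variables (m : nat) (v : 'I_m -> int).

Definition psum (k : nat) : int := \sum_(i < m | (i < k)%N) v i.

Lemma psum0 : psum 0 = 0.
Proof. by rewrite /psum big_pred0. Qed.

Lemma psumS (k : 'I_m) : psum k.+1 = psum k + v k.
Proof.
rewrite /psum (bigD1 k) //= addrC; congr (_ + _).
by apply: eq_bigl => i; rewrite -val_eqE /=; lia.
Qed.

Lemma psum_all : psum m = \sum_i v i.
Proof. by apply: eq_bigl => i; rewrite ltn_ord. Qed.

Definition zero_one (x : int) := (x == 0) || (x == 1).

Lemma alternating_psum :
    (forall i, v i \in [:: -1; 0; 1]) -> \sum_i v i = 1 -> alternating v ->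
  forall k, (k <= m)%N -> zero_one (psum k).
Proof.
move=> v3 vsum /forallP valt.
have [i0 /= nz0 min0] : exists2 i0, v i0 != 0 & forall i, v i != 0 -> (i0 <= i)%N.
  have [/existsP[j nzj]|/existsPn z] := boolP [exists i, v i != 0].
    by case: (@arg_minnP _ j (fun i => v i != 0) val nzj) => i0 ? ?; exists i0.
  by move: vsum; rewrite big1 // => i _; have := z i; rewrite negbK => /eqP.
pose s := v i0.
have s2 : s = 1 \/ s = -1.
  by have := v3 i0; rewrite !inE -/s; move: nz0; rewrite -/s; lia.
have key k : (k <= m)%N ->
  [\/ psum k = 0 /\ (forall i : 'I_m, (i < k)%N -> v i = 0),
      psum k = 0 /\ exists l : 'I_m, [/\ (l < k)%N, v l = - s &
         forall i : 'I_m, (l < i < k)%N -> v i = 0] |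
      psum k = s /\ exists l : 'I_m, [/\ (l < k)%N, v l = s &
         forall i : 'I_m, (l < i < k)%N -> v i = 0]].
  elim: k => [|k IHk] km; first by apply: Or31; rewrite psum0; split => // i.
  have ltS (i : 'I_m) : (i < k.+1)%N -> i = Ordinal km \/ (i < k)%N.
    rewrite ltnS leq_eqVlt => /orP[/eqP ik|]; last by right.
    by left; apply: val_inj.
  have step (l : 'I_m) : (l < k)%N -> v l != 0 ->
      (forall i : 'I_m, (l < i < k)%N -> v i = 0) ->
      v (Ordinal km) != 0 -> v (Ordinal km) = - v l.
    move=> lk nzl zl nzk; have /forallP/(_ (Ordinal km))/implyP := valt l.
    move=> H; apply/eqP/H; rewrite lk nzl nzk /=.
    by apply/forallP => i; apply/implyP => /zl->.
  rewrite (psumS (Ordinal km)) /=.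
  have last_k w : v (Ordinal km) = w -> exists l : 'I_m, [/\ (l < k.+1)%N, v l = w &
         forall i : 'I_m, (l < i < k.+1)%N -> v i = 0].
    by move=> e; exists (Ordinal km); split=> //= i; lia.
  have keep w : (exists l : 'I_m, [/\ (l < k)%N, v l = w &
         forall i : 'I_m, (l < i < k)%N -> v i = 0]) -> v (Ordinal km) = 0 ->
       exists l : 'I_m, [/\ (l < k.+1)%N, v l = w &
         forall i : 'I_m, (l < i < k.+1)%N -> v i = 0].
    move=> [l [lk vl zl]] z; exists l; split=> //; first exact: ltnW.
    by move=> i /andP[li /ltS[->//|ik]]; apply: zl; rewrite li.
  have [z|nz] := eqVneq (v (Ordinal km)) 0.
    rewrite z addr0; case: (IHk (ltnW km)) => -[-> H].
    - by apply: Or31; split=> // i /ltS[->//|/H].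
    - by apply: Or32; split=> //; apply: keep.
    - by apply: Or33; split=> //; apply: keep.
  case: (IHk (ltnW km)) => -[-> H].
  - apply: Or33; have e : v (Ordinal km) = s.
      congr v; apply: val_inj; apply/eqP; rewrite eqn_leq (min0 _ nz) andbT /=.
      by rewrite leqNgt; apply: contra nz0 => /H ->.
    by rewrite e add0r; split=> //; apply: last_k.
  - apply: Or33; case: H => l [lk vl zl].
    have e : v (Ordinal km) = s.
      by rewrite (step l) // vl ?opprK //; move: s2; lia.
    by rewrite e add0r; split=> //; apply: last_k.
  - apply: Or32; case: H => l [lk vl zl].
    have e : v (Ordinal km) = - s.
      by rewrite (step l) // vl //; move: s2; lia.
    by rewrite e addrN; split=> //; apply: last_k.
have s1 : s = 1.
  have := key m (leqnn m); rewrite psum_all vsum => -[|[]|[]] => [[]//|//|<-//].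
move=> k km; rewrite /zero_one.
by case: (key k km) => -[-> _]; rewrite ?s1.
Qed.

Lemma psum_alternating :
    (forall k, (k <= m)%N -> zero_one (psum k)) -> psum m = 1 ->
  [/\ forall i, v i \in [:: -1; 0; 1], \sum_i v i = 1 & alternating v].
Proof.
move=> H tot; split; last 2 first.
- by rewrite -psum_all.
- apply/forallP => j; apply/forallP => k; apply/implyP => /and4P[jk nzj nzk /forallP z].
  have cst d : (j.+1 + d <= k)%N -> psum (j.+1 + d) = psum j.+1.
    elim: d => [|d IHd] dk; first by rewrite addn0.
    have dm : (j.+1 + d < m)%N by apply: leq_trans (ltn_ord k); lia.
    rewrite addnS (psumS (Ordinal dm)) /= IHd; last by lia.
    have /implyP/(_ _)/eqP -> := z (Ordinal dm); first by rewrite addr0.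
    by rewrite /=; lia.
  have := cst (k - j.+1)%N; rewrite subnKC // => /(_ (leqnn _)) e.
  move: (H j (ltnW (ltn_ord j))) (H j.+1 (ltn_ord j)) (H k.+1 (ltn_ord k)).
  by move: nzj nzk; rewrite (psumS k) e (psumS j) /zero_one; lia.
- move=> i; move: (H i (ltnW (ltn_ord i))) (H i.+1 (ltn_ord i)).
  by rewrite psumS !inE /zero_one; lia.
Qed.

End AlternatingSums.

Section Corner.
Variable n : nat.
Implicit Types (f g : nat -> nat -> int).

Definition corner_spec f : Prop :=
  [/\ forall i, (i <= n)%N -> f i 0%N = 0 /\ f i n = i%:Z,
      forall j, (j <= n)%N -> f 0%N j = 0 /\ f n j = j%:Z,
      forall i j, (i < n)%N -> (j <= n)%N -> zero_one (f i.+1 j - f i j) &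
      forall i j, (i <= n)%N -> (j < n)%N -> zero_one (f i j.+1 - f i j)].

Definition of_corner f : 'M[int]_n :=
  \matrix_(i, j) (f i.+1 j.+1 - f i.+1 j - f i j.+1 + f i j).

Lemma corner0l (A : 'M[int]_n) j : corner A 0 j = 0.
Proof. by rewrite /corner big_pred0. Qed.

Lemma corner0r (A : 'M[int]_n) i : corner A i 0 = 0.
Proof. by rewrite /corner big1 // => i' _; rewrite big_pred0. Qed.

Lemma cornerSl (A : 'M[int]_n) (i : 'I_n) j : corner A i.+1 j = corner A i j + psum (A i) j.
Proof. exact: (psumS (fun i' => \sum_(j' < n | (j' < j)%N) A i' j')). Qed.

Lemma corner_exch (A : 'M[int]_n) i j :
  corner A i j = \sum_(j' < n | (j' < j)%N) \sum_(i' < n | (i' < i)%N) A i' j'.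
Proof. exact: exchange_big. Qed.

Lemma cornerSr (A : 'M[int]_n) i (j : 'I_n) :
  corner A i j.+1 = corner A i j + psum (fun i' => A i' j) i.
Proof.
by rewrite !corner_exch; exact: (psumS (fun j' => \sum_(i' < n | (i' < i)%N) A i' j')).
Qed.

Lemma of_cornerK (A : 'M[int]_n) : of_corner (corner A) = A.
Proof. by apply/matrixP => i j; rewrite mxE !cornerSl psumS; lia. Qed.

Lemma is_asmP (A : 'M[int]_n) : reflect
  [/\ forall i, [/\ forall j, A i j \in [:: -1; 0; 1], \sum_j A i j = 1
                  & alternating (fun j => A i j)] &
      forall j, [/\ forall i, A i j \in [:: -1; 0; 1], \sum_i A i j = 1
                  & alternating (fun i => A i j)]] (is_asm A).
Proof.
apply: (iffP and5P) => [[/'forall_forallP e /'forall_eqP r /'forall_eqP c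
    /forallP ar /forallP ac]|[r c]]; first by [].
split; first (apply/'forall_forallP => i; by case: (r i)).
- by apply/'forall_eqP => i; case: (r i).
- by apply/'forall_eqP => j; case: (c j).
- by apply/forallP => i; case: (r i).
- by apply/forallP => j; case: (c j).
Qed.

Lemma corner_asm (A : 'M[int]_n) : is_asm A -> corner_spec (corner A).
Proof.
case/is_asmP => r c.
have pr (i : 'I_n) j : (j <= n)%N -> zero_one (psum (A i) j).
  by have [H1 H2 H3] := r i; apply: alternating_psum.
have pc (j : 'I_n) i : (i <= n)%N -> zero_one (psum (fun i' => A i' j) i).
  by have [H1 H2 H3] := c j; apply: alternating_psum.
split.
- move=> i; split; first exact: corner0r.
  elim: i H => [|i IHi] H; first exact: corner0l.
  rewrite (cornerSl _ (Ordinal H)) /= IHi; last exact: ltnW.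
  by rewrite psum_all; have [_ -> _] := r (Ordinal H); lia.
- move=> j; split; first exact: corner0l.
  elim: j H => [|j IHj] H; first exact: corner0r.
  rewrite (cornerSr _ _ (Ordinal H)) /= IHj; last exact: ltnW.
  by rewrite psum_all; have [_ -> _] := c (Ordinal H); lia.
- by move=> i j ilt jle; rewrite (cornerSl _ (Ordinal ilt)) addrC addKr pr.
- by move=> i j ile jlt; rewrite (cornerSr _ _ (Ordinal jlt)) addrC addKr pc.
Qed.

Lemma of_corner_row f (i : 'I_n) j : corner_spec f -> (j <= n)%N ->
  psum (of_corner f i) j = f i.+1 j - f i j.
Proof.
case=> b0 b1 d0 d1; elim: j => [|j IHj] jn.
  have [-> _] := b0 _ (ltn_ord i); have [-> _] := b0 i (ltnW (ltn_ord i)).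
  by rewrite psum0.
by rewrite (psumS _ (Ordinal jn)) /= IHj ?(ltnW jn) // mxE /=; lia.
Qed.

Lemma of_corner_col f i (j : 'I_n) : corner_spec f -> (i <= n)%N ->
  psum (fun i' => of_corner f i' j) i = f i j.+1 - f i j.
Proof.
case=> b0 b1 d0 d1; elim: i => [|i IHi] jn.
  have [-> _] := b1 _ (ltn_ord j); have [-> _] := b1 j (ltnW (ltn_ord j)).
  by rewrite psum0.
by rewrite (psumS _ (Ordinal jn)) /= IHi ?(ltnW jn) // mxE /=; lia.
Qed.

Lemma corner_of_corner f i j : corner_spec f -> (i <= n)%N -> (j <= n)%N ->
  corner (of_corner f) i j = f i j.
Proof.
move=> fP ile jle; have [b0 b1 d0 d1] := fP.
elim: i ile => [|i IHi] ile; first by have [-> _] := b1 j jle; apply: corner0l.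
by rewrite (cornerSl _ (Ordinal ile)) of_corner_row //= IHi ?(ltnW ile) //; lia.
Qed.

Lemma of_corner_asm f : corner_spec f -> is_asm (of_corner f).
Proof.
move=> fP; have [b0 b1 d0 d1] := fP.
apply/is_asmP; split=> k; apply: psum_alternating.
- by move=> j jn; rewrite of_corner_row // d0.
- rewrite of_corner_row //.
  by have [_ ->] := b0 _ (ltn_ord k); have [_ ->] := b0 k (ltnW (ltn_ord k)); lia.
- by move=> i ile; rewrite of_corner_col // d1.
- rewrite of_corner_col //.
  by have [_ ->] := b1 _ (ltn_ord k); have [_ ->] := b1 k (ltnW (ltn_ord k)); lia.
Qed.

Lemma corner_max f g : corner_spec f -> corner_spec g ->
  corner_spec (fun i j => Num.max (f i j) (g i j)).
Proof.
move=> [f0 f1 f2 f3] [g0 g1 g2 g3]; split.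
- by move=> i ile; have := f0 i ile; have := g0 i ile; lia.
- by move=> i ile; have := f1 i ile; have := g1 i ile; lia.
- move=> i j il jl; have := f2 i j il jl; have := g2 i j il jl.
  by rewrite /zero_one; lia.
- move=> i j il jl; have := f3 i j il jl; have := g3 i j il jl.
  by rewrite /zero_one; lia.
Qed.

Lemma corner_min f g : corner_spec f -> corner_spec g ->
  corner_spec (fun i j => Num.min (f i j) (g i j)).
Proof.
move=> [f0 f1 f2 f3] [g0 g1 g2 g3]; split.
- by move=> i ile; have := f0 i ile; have := g0 i ile; lia.
- by move=> i ile; have := f1 i ile; have := g1 i ile; lia.
- move=> i j il jl; have := f2 i j il jl; have := g2 i j il jl.
  by rewrite /zero_one; lia.
- move=> i j il jl; have := f3 i j il jl; have := g3 i j il jl.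
  by rewrite /zero_one; lia.
Qed.

Lemma asm_corner (A : asm n) : corner_spec (corner A).
Proof. by apply: corner_asm; case: A. Qed.

(* The meet takes the entrywise minimum of height functions, i.e. the entrywise
   maximum of corner sums. *)
Definition asm_meet (A B : asm n) : asm n :=
  Asm (of_corner_asm (corner_max (asm_corner A) (asm_corner B))).
Definition asm_join (A B : asm n) : asm n :=
  Asm (of_corner_asm (corner_min (asm_corner A) (asm_corner B))).

Lemma asm_leP (A B : asm n) : reflect
  (forall i j, (i <= n)%N -> (j <= n)%N -> corner B i j <= corner A i j)
  (asm_le A B).
Proof.
apply: (iffP forallP) => [H i j ile jle|H i].
  have /forallP/(_ (inord j)) := H (inord i).
  by rewrite !mxE !inordK ?ltnS //; lia.
apply/forallP => j; rewrite !mxE.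
by have := H i j (ltn_ord i) (ltn_ord j); lia.
Qed.

Lemma asm_meet_corner (A B : asm n) i j : (i <= n)%N -> (j <= n)%N ->
  corner (asm_meet A B) i j = Num.max (corner A i j) (corner B i j).
Proof. by move=> *; apply: corner_of_corner => //; apply: corner_max; apply: asm_corner. Qed.

Lemma asm_join_corner (A B : asm n) i j : (i <= n)%N -> (j <= n)%N ->
  corner (asm_join A B) i j = Num.min (corner A i j) (corner B i j).
Proof. by move=> *; apply: corner_of_corner => //; apply: corner_min; apply: asm_corner. Qed.

Lemma asm_le_refl : reflexive (@asm_le n).
Proof. by move=> A; apply/asm_leP. Qed.

Lemma asm_le_anti : antisymmetric (@asm_le n).
Proof.
move=> A B /andP[/asm_leP AB /asm_leP BA]; apply: val_inj => /=.
rewrite -[asm_mx A]of_cornerK -[asm_mx B]of_cornerK.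
have E i j : (i <= n)%N -> (j <= n)%N -> corner A i j = corner B i j.
  by move=> il jl; have := AB i j il jl; have := BA i j il jl; lia.
by apply/matrixP => i j; rewrite !mxE !E // ltnW.
Qed.

Lemma asm_le_trans : transitive (@asm_le n).
Proof.
move=> B A C /asm_leP AB /asm_leP BC; apply/asm_leP => i j il jl.
exact: le_trans (BC i j il jl) (AB i j il jl).
Qed.

Lemma asm_meetP (A B C : asm n) : asm_le A (asm_meet B C) = asm_le A B && asm_le A C.
Proof.
apply/asm_leP/andP => [H|[/asm_leP H /asm_leP K] i j il jl].
  split; apply/asm_leP => i j il jl;
    by have := H i j il jl; rewrite asm_meet_corner //; lia.
by rewrite asm_meet_corner //; have := H i j il jl; have := K i j il jl; lia.
Qed.

Lemma asm_joinP (A B C : asm n) : asm_le (asm_join A B) C = asm_le A C && asm_le B C.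
Proof.
apply/asm_leP/andP => [H|[/asm_leP H /asm_leP K] i j il jl].
  split; apply/asm_leP => i j il jl;
    by have := H i j il jl; rewrite asm_join_corner //; lia.
by rewrite asm_join_corner //; have := H i j il jl; have := K i j il jl; lia.
Qed.

End Corner.

Fact asm_display : Order.disp_t. Proof. exact: Order.Disp tt tt. Qed.

HB.instance Definition _ n := Order.Le_isPOrder.Build asm_display (asm n)
  (@asm_le_refl n) (@asm_le_anti n) (@asm_le_trans n).
HB.instance Definition _ n := Order.POrder_MeetJoin_isLattice.Build
  asm_display (asm n) (@asm_meetP n) (@asm_joinP n).

Lemma perm_mx_asm n (s : 'S_n) : is_asm (perm_mx s : 'M[int]_n).
Proof.
have E i j : (perm_mx s : 'M[int]_n) i j = (s i == j)%:R by rewrite !mxE.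
have E' i j : (perm_mx s : 'M[int]_n) i j = (i == (s^-1)%g j)%:R.
  by rewrite E (can2_eq (permK s) (permKV s)).
apply/is_asmP; split=> k; split.
- by move=> j; rewrite E; case: eqP.
- under eq_bigr => j _ do rewrite E.
  by rewrite (bigD1 (s k)) //= eqxx big1 ?addr0 // => j /negPf; rewrite eq_sym => ->.
- apply/forallP => j; apply/forallP => l; rewrite !E; apply/implyP.
  by case: (s k =P j) => [<-|_]; case: (s k =P l) => [<-|_]; rewrite ?ltnn ?andbF.
- by move=> i; rewrite E; case: eqP.
- under eq_bigr => i _ do rewrite E'.
  by rewrite (bigD1 ((s^-1)%g k)) //= eqxx big1 ?addr0 // => i /negPf ->.
- apply/forallP => j; apply/forallP => l; rewrite !E'; apply/implyP.
  by case: (j =P _) => [->|_]; case: (l =P _) => [->|_]; rewrite ?ltnn ?andbF.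
Qed.

(* [perm_mx s] has entries [(s i == j)%:R], which is the convention for P_s. *)
Definition asm_perm n (s : 'S_n) : asm n := Asm (perm_mx_asm s).

(* Only the relative order of the entries of [p] matters. *)
Definition contains_pattern n (s : 'S_n) (p : seq nat) : bool :=
  [exists f : {ffun 'I_(size p) -> 'I_n},
    [forall a : 'I_(size p), forall b : 'I_(size p), (a < b)%N ==>
      (f a < f b)%N && ((s (f a) < s (f b))%N == (nth 0%N p a < nth 0%N p b)%N)]].

Definition avoids n (s : 'S_n) (p : seq nat) : bool := ~~ contains_pattern s p.

Definition covexillary n (s : 'S_n) : bool := avoids s [:: 3; 4; 1; 2].

Definition step (b : bool) : int := if b then 1 else -1.

Definition height (s : seq bool) (k : nat) : int := \sum_(b <- take k s) step b.

Definition is_dyck n (p : (2 * n).-tuple bool) : bool :=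
  [forall k : 'I_(2 * n).+1, 0 <= height p k] && (height p (2 * n) == 0).

Record dyck n := Dyck { dyck_steps :> (2 * n).-tuple bool; _ : is_dyck dyck_steps }.

HB.instance Definition _ n := [isSub for @dyck_steps n].
HB.instance Definition _ n := [Choice of dyck n by <:].

Definition dyck_le n (p q : dyck n) : bool :=
  [forall k : 'I_(2 * n).+1, height p k <= height q k].

Section Dyck.

Lemma heightS s k : (k < size s)%N ->
  height s k.+1 = height s k + step (nth false s k).
Proof. by move=> ks; rewrite /height (take_nth false) // -cats1 big_cat big_seq1. Qed.

Variable n : nat.
Implicit Types (f g : nat -> int) (p q : dyck n).

Definition dyck_spec f : Prop :=
  [/\ f 0%N = 0, f (2 * n)%N = 0, forall k, (k <= 2 * n)%N -> 0 <= f k &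
      forall k, (k < 2 * n)%N -> f k.+1 = f k + 1 \/ f k.+1 = f k - 1].

Definition of_height f : (2 * n).-tuple bool := [tuple f k < f k.+1 | k < 2 * n].

Lemma height_of_height f k : dyck_spec f -> (k <= 2 * n)%N ->
  height (of_height f) k = f k.
Proof.
case=> f0 _ _ fS; elim: k => [|k IHk] kn.
  by rewrite /height take0 big_nil f0.
rewrite heightS ?size_tuple // IHk ?(ltnW kn) //.
rewrite -[k in nth _ _ k]/(val (Ordinal kn)) -tnth_nth tnth_mktuple /=.
by rewrite /step; have := fS k kn; case: (ltP (f k) (f k.+1)); lia.
Qed.

Lemma of_height_dyck f : dyck_spec f -> is_dyck (of_height f).
Proof.
move=> fP; have [f0 f1 f2 f3] := fP; apply/andP; split.
  apply/forallP => k; have kn : (k <= 2 * n)%N by rewrite -ltnS.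
  by rewrite height_of_height // f2.
by rewrite height_of_height // f1.
Qed.

Lemma height_dyck p : dyck_spec (height p).
Proof.
case: p => p /= /andP[/forallP H /eqP H0]; split=> //.
- by rewrite /height take0 big_nil.
- by move=> k; rewrite -ltnS => kn; apply: (H (Ordinal kn)).
- move=> k kn; rewrite heightS ?size_tuple // /step.
  by case: nth; [left|right].
Qed.

Lemma dyck_spec_parity f k : dyck_spec f -> (k <= 2 * n)%N ->
  exists z : int, f k = k%:Z + 2 * z.
Proof.
case=> f0 _ _ fS; elim: k => [|k IHk] kn; first by exists 0; rewrite f0.
have [z e] := IHk (ltnW kn).
by case: (fS k kn) => ->; [exists z|exists (z - 1)]; rewrite e; lia.
Qed.

Lemma dyck_spec_min f g : dyck_spec f -> dyck_spec g ->
  dyck_spec (fun k => Num.min (f k) (g k)).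
Proof.
move=> fP gP; have [f0 f1 f2 f3] := fP; have [g0 g1 g2 g3] := gP.
split; rewrite ?f0 ?f1 ?g0 ?g1 // => k kn.
  by have := f2 k kn; have := g2 k kn; lia.
have [x ex] := dyck_spec_parity fP (ltnW kn).
have [y ey] := dyck_spec_parity gP (ltnW kn).
by have := f3 k kn; have := g3 k kn; lia.
Qed.

Lemma dyck_spec_max f g : dyck_spec f -> dyck_spec g ->
  dyck_spec (fun k => Num.max (f k) (g k)).
Proof.
move=> fP gP; have [f0 f1 f2 f3] := fP; have [g0 g1 g2 g3] := gP.
split; rewrite ?f0 ?f1 ?g0 ?g1 // => k kn.
  by have := f2 k kn; have := g2 k kn; lia.
have [x ex] := dyck_spec_parity fP (ltnW kn).
have [y ey] := dyck_spec_parity gP (ltnW kn).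
by have := f3 k kn; have := g3 k kn; lia.
Qed.

Definition dyck_meet p q : dyck n :=
  Dyck (of_height_dyck (dyck_spec_min (height_dyck p) (height_dyck q))).
Definition dyck_join p q : dyck n :=
  Dyck (of_height_dyck (dyck_spec_max (height_dyck p) (height_dyck q))).

Lemma dyck_meet_height p q k : (k <= 2 * n)%N ->
  height (dyck_meet p q) k = Num.min (height p k) (height q k).
Proof.
move=> kn; rewrite height_of_height //.
by apply: dyck_spec_min; apply: height_dyck.
Qed.

Lemma dyck_join_height p q k : (k <= 2 * n)%N ->
  height (dyck_join p q) k = Num.max (height p k) (height q k).
Proof.
move=> kn; rewrite height_of_height //.
by apply: dyck_spec_max; apply: height_dyck.
Qed.

Lemma dyck_leP p q : reflect
  (forall k, (k <= 2 * n)%N -> height p k <= height q k) (dyck_le p q).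
Proof.
apply: (iffP forallP) => [H k|H k]; last by apply: H; rewrite -ltnS.
by rewrite -ltnS => kn; apply: (H (Ordinal kn)).
Qed.

Lemma dyck_le_refl : reflexive (@dyck_le n).
Proof. by move=> p; apply/dyck_leP. Qed.

Lemma dyck_le_anti : antisymmetric (@dyck_le n).
Proof.
move=> p q /andP[/dyck_leP pq /dyck_leP qp]; apply: val_inj; apply: eq_from_tnth => k.
have E j : (j <= 2 * n)%N -> height p j = height q j.
  by move=> jn; have := pq j jn; have := qp j jn; lia.
have := E k.+1 (ltn_ord k); rewrite !heightS ?size_tuple // E ?(ltnW (ltn_ord k)) //.
by move/addrI; rewrite !(tnth_nth false) /step; do 2!case: nth.
Qed.

Lemma dyck_le_trans : transitive (@dyck_le n).
Proof.
move=> q p r /dyck_leP pq /dyck_leP qr; apply/dyck_leP => k kn.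
exact: le_trans (pq k kn) (qr k kn).
Qed.

Lemma dyck_meetP p q r : dyck_le p (dyck_meet q r) = dyck_le p q && dyck_le p r.
Proof.
apply/dyck_leP/andP => [H|[/dyck_leP H /dyck_leP K] k kn].
  by split; apply/dyck_leP => k kn; have := H k kn; rewrite dyck_meet_height //; lia.
by rewrite dyck_meet_height //; have := H k kn; have := K k kn; lia.
Qed.

Lemma dyck_joinP p q r : dyck_le (dyck_join p q) r = dyck_le p r && dyck_le q r.
Proof.
apply/dyck_leP/andP => [H|[/dyck_leP H /dyck_leP K] k kn].
  by split; apply/dyck_leP => k kn; have := H k kn; rewrite dyck_join_height //; lia.
by rewrite dyck_join_height //; have := H k kn; have := K k kn; lia.
Qed.

End Dyck.

Fact dyck_display : Order.disp_t. Proof. exact: Order.Disp tt tt. Qed.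

HB.instance Definition _ n := Order.Le_isPOrder.Build dyck_display (dyck n)
  (@dyck_le_refl n) (@dyck_le_anti n) (@dyck_le_trans n).
HB.instance Definition _ n := Order.POrder_MeetJoin_isLattice.Build
  dyck_display (dyck n) (@dyck_meetP n) (@dyck_joinP n).

Definition catalan n (c : congruence (asm n)) : Prop :=
  exists f : {lmorphism congr_quot c -> dyck n}, bijective f.

Section GroupAlgebra.
Variables (F : fieldType) (gT : finGroupType).

(* An alias, because [{ffun gT -> F}] already carries the pointwise product. *)
Definition group_algebra : Type := {ffun gT -> F^o}.
HB.instance Definition _ := Vector.on group_algebra.

Implicit Types a b c : group_algebra.

Definition ga_of (x : gT) : group_algebra := [ffun y => (y == x)%:R].

Definition ga_mul a b : group_algebra := [ffun x => \sum_y a y * b (y^-1 * x)%g].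

Lemma ga_mulA : associative ga_mul.
Proof.
move=> a b c; apply/ffunP => x; rewrite !ffunE.
transitivity (\sum_y \sum_z a y * b z * c (z^-1 * (y^-1 * x))%g).
  apply: eq_bigr => y _; rewrite ffunE big_distrr.
  by apply: eq_bigr => z _; rewrite /= mulrA.
under [RHS]eq_bigr => w _ do rewrite ffunE big_distrl /=.
rewrite [RHS]exchange_big; apply: eq_bigr => y _.
rewrite [RHS](reindex_inj (mulgI y)); apply: eq_bigr => z _ /=.
by rewrite mulKg invMg mulgA.
Qed.

Lemma ga_mul1r : left_id (ga_of 1%g) ga_mul.
Proof.
move=> a; apply/ffunP => x; rewrite ffunE (bigD1 1%g) //= ffunE eqxx mul1r.
rewrite invg1 mul1g big1 ?addr0 // => y /negPf ny.
by rewrite ffunE ny mul0r.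
Qed.

Lemma ga_mulr1 : right_id (ga_of 1%g) ga_mul.
Proof.
move=> a; apply/ffunP => x; rewrite ffunE (bigD1 x) //= ffunE mulVg eqxx mulr1.
rewrite big1 ?addr0 // => y ny.
by rewrite ffunE -eq_mulVg1 (negPf ny) mulr0.
Qed.

Lemma ga_mulDl : left_distributive ga_mul +%R.
Proof.
move=> a b c; apply/ffunP => x; rewrite !ffunE -big_split.
by apply: eq_bigr => y _; rewrite ffunE mulrDl.
Qed.

Lemma ga_mulDr : right_distributive ga_mul +%R.
Proof.
move=> a b c; apply/ffunP => x; rewrite !ffunE -big_split.
by apply: eq_bigr => y _; rewrite ffunE mulrDr.
Qed.

Lemma ga_oner_neq0 : ga_of 1%g != 0.
Proof.
by apply/eqP => /ffunP/(_ 1%g); rewrite !ffunE eqxx => /eqP; rewrite oner_eq0.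
Qed.

HB.instance Definition _ := GRing.Zmodule_isNzRing.Build group_algebra
  ga_mulA ga_mul1r ga_mulr1 ga_mulDl ga_mulDr ga_oner_neq0.

Lemma ga_scaleAl (k : F) a b : k *: (a * b) = (k *: a) * b.
Proof.
apply/ffunP => x; rewrite !ffunE scaler_sumr; apply: eq_bigr => y _ /=.
by rewrite ffunE scalerAl.
Qed.

Lemma ga_scaleAr (k : F) a b : k *: (a * b) = a * (k *: b).
Proof.
apply/ffunP => x; rewrite !ffunE scaler_sumr; apply: eq_bigr => y _ /=.
by rewrite ffunE scalerAr.
Qed.

HB.instance Definition _ :=
  GRing.Lmodule_isLalgebra.Build F group_algebra ga_scaleAl.
HB.instance Definition _ :=
  GRing.Lalgebra_isAlgebra.Build F group_algebra ga_scaleAr.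
HB.instance Definition _ := Algebra_isFalgebra.Build F group_algebra.

Lemma ga_ofM x y : ga_of (x * y)%g = ga_of x * ga_of y.
Proof.
apply/ffunP => z; rewrite !ffunE (bigD1 x) //= !ffunE eqxx mul1r.
rewrite big1 ?addr0 => [|t /negPf nt]; last by rewrite ffunE nt mul0r.
congr (_%:R); congr nat_of_bool.
by apply/eqP/eqP => [->|<-]; rewrite ?mulKg ?mulVKg.
Qed.

End GroupAlgebra.

Section TemperleyLieb.
Variables (F : fieldType) (n : nat).
Local Notation GA := (group_algebra F 'S_n).

(* Permutations compose left to right: [tperm i j * tperm i k] is the cycle
   i -> j -> k -> i and [tperm i k * tperm i j] is its inverse. *)
Definition tl_gen (i j k : 'I_n) : GA :=
  ga_of F 1%g - ga_of F (tperm i j) - ga_of F (tperm j k) - ga_of F (tperm i k)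
  + ga_of F (tperm i j * tperm i k)%g + ga_of F (tperm i k * tperm i j)%g.

Definition tl_gens : seq GA :=
  [seq tl_gen t.1.1 t.1.2 t.2 |
    t : 'I_n * 'I_n * 'I_n <- enum {: 'I_n * 'I_n * 'I_n} & (t.1.1 < t.1.2 < t.2)%N].

(* The two-sided ideal generated by a set in a unital algebra is spanned by the
   products a * g * b; see [tl_ideal_min]. *)
Definition tl_ideal : {vspace GA} := (fullv * <<tl_gens>> * fullv)%VS.

Lemma tl_idealMl a x : x \in tl_ideal -> a * x \in tl_ideal.
Proof.
move=> xI; have := memv_mul (memvf a) xI; rewrite /tl_ideal !prodvA.
by apply: subvP; rewrite !prodvSl // subvf.
Qed.

Lemma tl_idealMr a x : x \in tl_ideal -> x * a \in tl_ideal.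
Proof.
move=> xI; have := memv_mul xI (memvf a); rewrite /tl_ideal -!prodvA.
by apply: subvP; rewrite !prodvSr // subvf.
Qed.

Lemma tl_gens_ideal : {subset tl_gens <= tl_ideal}.
Proof.
move=> g gG; rewrite -[g]mul1r -[1 * g]mulr1 /tl_ideal.
by rewrite !memv_mul ?memvf // memv_span.
Qed.

Lemma tl_ideal_min (J : {vspace GA}) :
    (forall a x, x \in J -> a * x \in J) ->
    (forall a x, x \in J -> x * a \in J) ->
  {subset tl_gens <= J} -> (tl_ideal <= J)%VS.
Proof.
move=> Jl Jr /span_subvP GJ; apply/prodvP => x b xG _; apply: Jr.
move: x xG; apply/subvP/prodvP => a x _ /(subvP GJ); exact: Jl.
Qed.

Definition ga_aug (a : GA) : F := \sum_x a x.

Lemma ga_aug_is_linear : linear_for *%R ga_aug.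
Proof.
move=> k a b; rewrite /ga_aug mulr_sumr -big_split.
by apply: eq_bigr => x _; rewrite !ffunE.
Qed.
HB.instance Definition _ := GRing.isLinear.Build F GA F *%R ga_aug ga_aug_is_linear.

Lemma ga_augM : {morph ga_aug : a b / a * b}.
Proof.
move=> a b; rewrite /ga_aug big_distrl /=.
under eq_bigr => x _ do rewrite ffunE.
rewrite exchange_big; apply: eq_bigr => y _ /=.
rewrite (reindex_inj (mulgI y)) /= big_distrr; apply: eq_bigr => z _ /=.
by rewrite mulKg.
Qed.

Lemma ga_aug_of x : ga_aug (ga_of F x) = 1.
Proof.
rewrite /ga_aug (bigD1 x) //= ffunE eqxx big1 ?addr0 // => y /negPf ny.
by rewrite ffunE ny.
Qed.

Lemma ga_aug_tl_ideal x : x \in tl_ideal -> ga_aug x = 0.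
Proof.
pose f : 'Hom(GA, F^o) := linfun (ga_aug : GA -> F^o).
have fE y : (y \in lker f) = (ga_aug y == 0) by rewrite memv_ker lfunE.
move=> xI; apply/eqP; rewrite -fE; move: x xI; apply/subvP/tl_ideal_min.
- by move=> a x; rewrite !fE ga_augM => /eqP->; rewrite mulr0.
- by move=> a x; rewrite !fE ga_augM => /eqP->; rewrite mul0r.
- move=> g /mapP[t _ ->]; rewrite fE !(raddfD, raddfN) /= !ga_aug_of.
  by rewrite subrr sub0r subrK addNr.
Qed.

Definition tl : Type := Quotient.quot tl_ideal.
HB.instance Definition _ := GRing.Zmodule.on tl.

Local Notation repr := (generic_quotient.repr).

Definition tl_proj (x : GA) : tl := (\pi_tl x)%qT.

Lemma tl_projP x y : reflect (tl_proj x = tl_proj y) (x - y \in tl_ideal).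
Proof. by rewrite (Quotient.idealrBE tl_ideal); apply: eqP. Qed.

Lemma tl_proj_repr (X : tl) : tl_proj (repr X) = X.
Proof. exact: reprK. Qed.

Lemma tl_projB : {morph tl_proj : x y / x - y}.
Proof. exact: (raddfB (\pi_(Quotient.quot tl_ideal)%qT)). Qed.
HB.instance Definition _ := GRing.isZmodMorphism.Build GA tl tl_proj tl_projB.

Definition tl_scale (k : F) (X : tl) : tl := tl_proj (k *: repr X).
Definition tl_mul (X Y : tl) : tl := tl_proj (repr X * repr Y).

Lemma tl_scaleE k x : tl_scale k (tl_proj x) = tl_proj (k *: x).
Proof.
apply/tl_projP; rewrite -scalerBr memvZ //.
by apply/tl_projP/tl_proj_repr.
Qed.

Lemma tl_mulE x y : tl_mul (tl_proj x) (tl_proj y) = tl_proj (x * y).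
Proof.
have H z : repr (tl_proj z) - z \in tl_ideal by apply/tl_projP/tl_proj_repr.
apply/tl_projP; set x' := repr _; set y' := repr _.
rewrite -(subrKA (x * y')) -mulrBr -mulrBl memvD //.
- exact: tl_idealMr (H x).
- exact: tl_idealMl (H y).
Qed.

Lemma tl_ind (P : tl -> Prop) : (forall x, P (tl_proj x)) -> forall X, P X.
Proof. by move=> H X; rewrite -[X]tl_proj_repr. Qed.

Lemma tl_scaleA a b X : tl_scale a (tl_scale b X) = tl_scale (a * b) X.
Proof. by elim/tl_ind: X => x; rewrite !tl_scaleE scalerA. Qed.
Lemma tl_scale1 : left_id 1 tl_scale.
Proof. by elim/tl_ind => x; rewrite tl_scaleE scale1r. Qed.
Lemma tl_scaleDr : right_distributive tl_scale +%R.
Proof.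
move=> a; elim/tl_ind => x; elim/tl_ind => y.
by rewrite -raddfD !tl_scaleE scalerDr raddfD.
Qed.
Lemma tl_scaleDl X : {morph tl_scale^~ X : a b / a + b}.
Proof. by move=> a b; elim/tl_ind: X => x; rewrite !tl_scaleE scalerDl raddfD. Qed.
HB.instance Definition _ := GRing.Zmodule_isLmodule.Build F tl
  tl_scaleA tl_scale1 tl_scaleDr tl_scaleDl.

Lemma tl_mulA : associative tl_mul.
Proof.
elim/tl_ind => x; elim/tl_ind => y; elim/tl_ind => z.
by rewrite !tl_mulE mulrA.
Qed.
Lemma tl_mul1r : left_id (tl_proj 1) tl_mul.
Proof. by elim/tl_ind => x; rewrite tl_mulE mul1r. Qed.
Lemma tl_mulr1 : right_id (tl_proj 1) tl_mul.
Proof. by elim/tl_ind => x; rewrite tl_mulE mulr1. Qed.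
Lemma tl_mulDl : left_distributive tl_mul +%R.
Proof.
elim/tl_ind => x; elim/tl_ind => y; elim/tl_ind => z.
by rewrite -raddfD !tl_mulE mulrDl raddfD.
Qed.
Lemma tl_mulDr : right_distributive tl_mul +%R.
Proof.
elim/tl_ind => x; elim/tl_ind => y; elim/tl_ind => z.
by rewrite -raddfD !tl_mulE mulrDr raddfD.
Qed.
Lemma tl_oner_neq0 : tl_proj 1 != 0.
Proof.
rewrite -(raddf0 tl_proj); apply/eqP => /tl_projP; rewrite subr0.
by move/ga_aug_tl_ideal/eqP; rewrite ga_aug_of oner_eq0.
Qed.
HB.instance Definition _ := GRing.Zmodule_isNzRing.Build tl
  tl_mulA tl_mul1r tl_mulr1 tl_mulDl tl_mulDr tl_oner_neq0.

Lemma tl_projZ k x : tl_proj (k *: x) = k *: tl_proj x.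
Proof. by rewrite -tl_scaleE. Qed.
Lemma tl_projM x y : tl_proj (x * y) = tl_proj x * tl_proj y.
Proof. by rewrite -tl_mulE. Qed.

Lemma tl_scaleAl (k : F) (X Y : tl) : k *: (X * Y) = (k *: X) * Y.
Proof.
elim/tl_ind: X => x; elim/tl_ind: Y => y.
by rewrite -tl_projM -!tl_projZ -tl_projM scalerAl.
Qed.
Lemma tl_scaleAr (k : F) (X Y : tl) : k *: (X * Y) = X * (k *: Y).
Proof.
elim/tl_ind: X => x; elim/tl_ind: Y => y.
by rewrite -tl_projM -!tl_projZ -tl_projM scalerAr.
Qed.
HB.instance Definition _ := GRing.Lmodule_isLalgebra.Build F tl tl_scaleAl.
HB.instance Definition _ := GRing.Lalgebra_isAlgebra.Build F tl tl_scaleAr.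

(* Coordinates of a class on the basis [vbasis tl_ideal^C]. *)
Definition tl_compl : 'End(GA) := (\1 - projv tl_ideal)%VF.

Lemma tl_complE x : tl_compl x = x - projv tl_ideal x.
Proof. by rewrite add_lfunE opp_lfunE id_lfunE. Qed.

Lemma tl_compl_ideal x : x \in tl_ideal -> tl_compl x = 0.
Proof. by move=> xI; rewrite tl_complE projv_id ?subrr. Qed.

Lemma tl_compl_id x : x \in (tl_ideal^C)%VS -> tl_compl x = x.
Proof.
by rewrite -lker_proj memv_ker => /eqP e; rewrite tl_complE e subr0.
Qed.

Lemma tl_proj_compl x : tl_proj (tl_compl x) = tl_proj x.
Proof.
by apply/tl_projP; rewrite tl_complE addrAC subrr sub0r memvN memv_proj.
Qed.

Definition tl_coord (X : tl) : 'rV[F]_(\dim (tl_ideal^C)) :=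
  \row_i coord (vbasis tl_ideal^C) i (tl_compl (repr X)).

Lemma tl_coordE x :
  tl_coord (tl_proj x) = \row_i coord (vbasis tl_ideal^C) i (tl_compl x).
Proof.
apply/rowP => i; rewrite !mxE; congr (coord _ i _).
have /tl_compl_ideal : repr (tl_proj x) - x \in tl_ideal.
  exact/tl_projP/tl_proj_repr.
by rewrite linearB => /subr0_eq.
Qed.

Lemma tl_coord_is_linear : linear tl_coord.
Proof.
move=> k; elim/tl_ind => x; elim/tl_ind => y.
rewrite -tl_projZ -raddfD !tl_coordE.
by apply/rowP => i; rewrite !mxE !linearP.
Qed.

Lemma tl_coord_bij : bijective tl_coord.
Proof.
exists (fun v : 'rV_(\dim (tl_ideal^C)) => tl_proj (\sum_i v 0 i *: (vbasis tl_ideal^C)`_i)).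
  elim/tl_ind => x; rewrite tl_coordE.
  under eq_bigr => i _ do rewrite mxE.
  by rewrite -coord_vbasis ?tl_proj_compl // tl_complE memv_projC.
move=> v; rewrite tl_coordE; apply/rowP => i; rewrite mxE tl_compl_id.
  by rewrite coord_sum_free // (basis_free (vbasisP _)).
by apply: memv_suml => j _; rewrite memvZ // vbasis_mem // mem_nth ?size_tuple.
Qed.

Lemma tl_vector : Vector.axiom (\dim (tl_ideal^C)) tl.
Proof. by exists tl_coord; [exact: tl_coord_is_linear | exact: tl_coord_bij]. Qed.

HB.instance Definition _ := Lmodule_hasFinDim.Build F tl tl_vector.
HB.instance Definition _ := Algebra_isFalgebra.Build F tl.

Definition tl_perm (s : 'S_n) : tl := tl_proj (ga_of F s).

End TemperleyLieb.

(* Main.v *)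
(* Write r(i, j) for the corner sums of a matrix.  A lattice quotient of the
   distributive lattice of alternating sign matrices is given by a set of
   join-irreducible elements, that is of conditions r(i, j) <= a.  Comparing ranks
   with the triangular poset of join-irreducible Dyck paths shows that a catalan
   congruence consists of exactly one condition r(p(a, b)) <= a for each pair with
   a + b <= n - 2, where p moves by one unit step along the rows or the columns,
   forwards when a increases and backwards when b increases; on the boundary
   a + b = n - 2 the position is (a + 1, a + 1).

   The maximum of a class is the pointwise least system of corner sums with
   r(p(a, b)) > a for (a, b) in a lower ideal.  As p is monotone along chains going
   up in a and down in b, it has no entry -1 and no pattern 3412.

   Undoing either inversion of the middle letter of a pattern 321 raises r by one on
   a box, and the two boxes never both contain a point with r(p(a, b)) = a, so one
   of these moves stays in the class.  A discrete intermediate value argument finds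
   such a point next to the middle letter, so the occurrence can be chosen with
   exactly one of the moves staying in the class.  The relation
   321 = 231 + 312 + 123 - 213 - 132 then shows that a permutation and the
   321-avoiding one in its class agree modulo strictly lower classes.  Each class
   has only one 321-avoiding element: this is direct for p(a, b) = (a + 1, n - 1 - b),
   and in general the number of classes is the same.  Hence all systems of
   representatives span, and they have as many elements as there are 321-avoiding
   permutations, which are independent by triangularity of their action on the
   tensor power of a plane. *)

Require Import Defs.
From HB Require Import structures.
From mathcomp Require Import all_boot all_order all_algebra all_fingroup all_field.
From mathcomp Require Import complex reals.
From mathcomp Require Import boolp zify ring.

Set Implicit Arguments.
Unset Strict Implicit.
Unset Printing Implicit Defensive.

Import Order.TTheory GRing.Theory Num.Theory.
Local Open Scope ring_scope.

(** * Corner sums *)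

Section CornerSums.
Variable n : nat.
Implicit Types (f : nat -> nat -> int) (A B : asm n) (s t : 'S_n).

Lemma corner_spec_lipl f i i' j : corner_spec n f -> (i <= i' <= n)%N -> (j <= n)%N ->
  f i j <= f i' j <= f i j + (i' - i)%:Z.
Proof.
case=> _ _ d _ /andP[ii' i'n] jn; rewrite -(subnKC ii') in i'n *.
elim: (i' - i)%N i'n => [|k IHk] kn; first by rewrite addn0; lia.
have ik : (i + k < n)%N by lia.
by have := d _ j ik jn; have := IHk (ltnW ik); rewrite addnS /zero_one; lia.
Qed.

Lemma corner_spec_lipr f i j j' : corner_spec n f -> (i <= n)%N -> (j <= j' <= n)%N ->
  f i j <= f i j' <= f i j + (j' - j)%:Z.
Proof.
case=> d0 d1 d2 d3 ile jj'.
have fT : corner_spec n (fun x y => f y x).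
  by split=> *; [apply: d1|apply: d0|apply: d3|apply: d2].
exact: (corner_spec_lipl fT).
Qed.

Lemma corner_spec_bounds f i j : corner_spec n f -> (i <= n)%N -> (j <= n)%N ->
  [/\ 0 <= f i j, (i + j)%:Z - n%:Z <= f i j, f i j <= i%:Z & f i j <= j%:Z].
Proof.
move=> fP ile jle; have [d0 d1 _ _] := fP.
have := corner_spec_lipl (i := 0) (i' := i) (j := j) fP; rewrite ile => /(_ isT jle).
have := corner_spec_lipr (i := i) (j := 0) (j' := j) fP; rewrite jle => /(_ ile isT).
have := corner_spec_lipr (i := i) (j := j) (j' := n) fP; rewrite jle leqnn.
move=> /(_ ile isT).
by have := d0 i ile; have := d1 j jle; split; lia.
Qed.

Lemma asm_le_corner A B : (A <= B)%O -> forall i j, (i <= n)%N -> (j <= n)%N ->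
  corner B i j <= corner A i j.
Proof. by move/asm_leP. Qed.

Lemma asm_eq A B : (forall i j, (i <= n)%N -> (j <= n)%N -> corner A i j = corner B i j) ->
  A = B.
Proof.
by move=> AB; apply/le_anti/andP; split; apply/asm_leP => i j il jl; rewrite AB.
Qed.

(** A strictly increasing rank, for inductions and extremal choices. The absolute value only
    converts to [nat]: corner sums are at most [i]. *)
Definition asm_ht A : nat :=
  \sum_(i < n.+1) \sum_(j < n.+1) `|i%:Z - corner A i j|%N.

Lemma asm_ht_mono A B : (A <= B)%O -> (asm_ht A <= asm_ht B)%N.
Proof.
move=> /asm_le_corner AB; apply: leq_sum => i _; apply: leq_sum => j _.
have [il jl] : (i <= n)%N /\ (j <= n)%N by have := ltn_ord i; have := ltn_ord j; lia.
by have := AB i j il jl; have [] := corner_spec_bounds (asm_corner A) il jl; lia.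
Qed.

Lemma asm_ht_lt A B : (A <= B)%O -> A != B -> (asm_ht A < asm_ht B)%N.
Proof.
move=> AB; rewrite ltnNge; apply: contraNN => BA; apply/eqP/asm_eq => i j il jl.
have le2 (k l : 'I_n.+1) : (`|k%:Z - corner A k l| <= `|k%:Z - corner B k l|)%N.
  have [kl ll] : (k <= n)%N /\ (l <= n)%N by have := ltn_ord k; have := ltn_ord l; lia.
  have := asm_le_corner AB kl ll; have [] := corner_spec_bounds (asm_corner A) kl ll; lia.
have le1 (k : 'I_n.+1) : (\sum_(l < n.+1) `|k%:Z - corner A k l| <=
                          \sum_(l < n.+1) `|k%:Z - corner B k l|)%N.
  exact: leq_sum.
have E : \sum_(k < n.+1) \sum_(l < n.+1) `|k%:Z - corner A k l|%N =
         \sum_(k < n.+1) \sum_(l < n.+1) `|k%:Z - corner B k l|%N.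
  by apply/eqP; rewrite eqn_leq -/(asm_ht A) -/(asm_ht B) BA (asm_ht_mono AB).
(* Termwise inequalities with equal totals are equalities: first between the row sums, then inside
   row [i]. *)
have [_] := leqif_sum (P := xpredT) (fun k _ => leqif_eq (le1 k)).
rewrite E eqxx => /esym/forall_inP/(_ (inord i) isT)/eqP E1.
have [_] := leqif_sum (P := xpredT) (fun l _ => leqif_eq (le2 (inord i) l)).
rewrite E1 eqxx => /esym/forall_inP/(_ (inord j) isT)/eqP; rewrite !inordK ?ltnS //.
have [? ? ? ?] := corner_spec_bounds (asm_corner A) il jl.
have [? ? ? ?] := corner_spec_bounds (asm_corner B) il jl; lia.
Qed.

End CornerSums.

(** * Corner sums of permutation matrices *)

Section PermCorner.
Variable n : nat.
Implicit Types (s t : 'S_n).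

Lemma corner_perm s i j :
  corner (asm_perm s) i j = #|[set p : 'I_n | (p < i)%N && (s p < j)%N]|%:Z.
Proof.
rewrite /corner /= cardsE -sum1_card; symmetry.
transitivity (\sum_(p < n | (p < i)%N && (s p < j)%N) 1 : int).
  by rewrite -natz natr_sum.
rewrite big_mkcondr; apply: eq_bigr => p _; case: ifP => sp.
  rewrite (bigD1 (s p)) //= !mxE eqxx big1 ?addr0 // => k /andP[_ /negPf].
  by rewrite !mxE eq_sym => ->.
by rewrite big1 // => k kj; rewrite !mxE; case: eqP => // E; rewrite E kj in sp.
Qed.

Lemma corner_permS s (p : 'I_n) j :
  corner (asm_perm s) p.+1 j = corner (asm_perm s) p j + (s p < j)%N%:Z.
Proof.
rewrite !corner_perm (cardsD1 p) inE ltnSn /= PoszD addrC; congr (_%:Z + _).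
by apply: eq_card => q; rewrite !inE -val_eqE /= ltnS (ltn_neqAle q) andbA.
Qed.

Lemma corner_perm_colS s i (p : 'I_n) :
  corner (asm_perm s) i (s p).+1 = corner (asm_perm s) i (s p) + (p < i)%N%:Z.
Proof.
rewrite !corner_perm (cardsD1 p) inE ltnSn /= andbT PoszD addrC; congr (_%:Z + _).
apply: eq_card => q; rewrite !inE -(inj_eq (@perm_inj _ s)) -val_eqE /= ltnS.
by rewrite (ltn_neqAle (s q)) andbCA.
Qed.

Lemma asm_perm_inj : injective (@asm_perm n).
Proof.
move=> s t st; apply/permP => p; apply: val_inj => /=.
have := congr1 (fun A : asm n => A p (s p)) st; rewrite /= !mxE eqxx.
by case: eqP => [<-|].
Qed.

Lemma card_ord_lt k : (k <= n)%N -> #|[set p : 'I_n | (p < k)%N]| = k.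
Proof.
move=> kn; rewrite cardsE -sum1_card (big_ord_narrow kn) /=.
by rewrite sum_nat_const card_ord muln1.
Qed.

Lemma corner_perm_gap s i j : (i <= n)%N -> corner (asm_perm s) i j < i%:Z ->
  exists2 p : 'I_n, (p < i)%N & (j <= s p)%N.
Proof.
move=> ile lt_i; have [/existsP[p /andP[pi jp]]|/existsPn H] :=
  boolP [exists p : 'I_n, (p < i)%N && (j <= s p)%N]; first by exists p.
move: lt_i; rewrite corner_perm -[X in _ < X%:Z](card_ord_lt ile).
rewrite (_ : [set p : 'I_n | _ & _] = [set p : 'I_n | (p < i)%N]) ?ltxx //.
by apply/setP => p; rewrite !inE; have := H p; lia.
Qed.

Lemma corner_perm_gap_col s i j : (j <= n)%N -> corner (asm_perm s) i j < j%:Z ->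
  exists2 p : 'I_n, (i <= p)%N & (s p < j)%N.
Proof.
move=> jle lt_j; have [/existsP[p /andP[pi jp]]|/existsPn H] :=
  boolP [exists p : 'I_n, (i <= p)%N && (s p < j)%N]; first by exists p.
move: lt_j; rewrite corner_perm -[X in _ < X%:Z](card_ord_lt jle).
rewrite (_ : [set p : 'I_n | _ & _] = s @^-1: [set p : 'I_n | (p < j)%N]).
  by rewrite card_preimset ?ltxx //; exact: perm_inj.
by apply/setP => p; rewrite !inE; have := H p; lia.
Qed.

(** Only the dots in rows [x] and [y] move, and together they gain one exactly on the box spanned by
    the inversion. *)
Lemma corner_tperm s (x y : 'I_n) i j : (x < y)%N -> (s y < s x)%N ->
  corner (asm_perm (tperm x y * s)%g) i j =
  corner (asm_perm s) i j + ((x < i <= y)%N && (s y < j <= s x)%N)%:Z.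
Proof.
move=> xy yx; have nxy : x != y by rewrite -val_eqE /=; lia.
rewrite !corner_perm.
pose D t := [set p : 'I_n | (p < i)%N && (t p < j)%N].
have E t : #|D t| = ((x \in D t) + (y \in D t) + #|D t :\ x :\ y|)%N.
  by rewrite (cardsD1 x) (cardsD1 y (D t :\ x)) !inE eq_sym nxy /= addnA.
rewrite -/(D s) -/(D (tperm x y * s)%g) !E.
have -> : D (tperm x y * s)%g :\ x :\ y = D s :\ x :\ y.
  apply/setP => p; rewrite !inE permM; case: (p =P y) => //= /eqP py.
  by case: (p =P x) => //= /eqP px; rewrite tpermD // eq_sym.
rewrite !inE !permM tpermL tpermR.
lia.
Qed.

Lemma tperm_le s (x y : 'I_n) : (x < y)%N -> (s y < s x)%N ->
  (asm_perm (tperm x y * s)%g <= asm_perm s)%O.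
Proof. by move=> xy yx; apply/asm_leP => i j _ _; rewrite corner_tperm //; lia. Qed.

End PermCorner.
(** * Families of join-irreducible elements *)

(* The join-irreducible elements of the quotient by a catalan congruence: the
   one indexed by [(a, b)] is the condition that the corner sum at
   [(pr a b, pc a b)] is at most [a]. *)
Record catalan_family (n : nat) (pr pc : nat -> nat -> nat) : Prop := CatalanFamily {
  cf_sum : forall a b, (a + b + 2 <= n)%N -> (pr a b + pc a b + b = n + a)%N;
  cf_stepl : forall a b, (a.+1 + b + 2 <= n)%N ->
    (pr a b <= pr a.+1 b)%N /\ (pc a b <= pc a.+1 b)%N;
  cf_stepr : forall a b, (a + b.+1 + 2 <= n)%N ->
    (pr a b.+1 <= pr a b)%N /\ (pc a b.+1 <= pc a b)%N;
  cf_diag : forall a b, (a + b + 2 = n)%N -> pr a b = a.+1 /\ pc a b = a.+1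
}.

Section Family.
Variables (n : nat) (pr pc : nat -> nat -> nat).
Hypothesis cf : catalan_family n pr pc.
Implicit Types (A B : asm n) (s t : 'S_n).

Lemma cf_monol a a' b : (a <= a')%N -> (a' + b + 2 <= n)%N ->
  (pr a b <= pr a' b)%N /\ (pc a b <= pc a' b)%N.
Proof.
move=> aa'; rewrite -(subnKC aa'); elim: (a' - a)%N => [|k IHk] H.
  by rewrite addn0.
have Hk : (a + k + b + 2 <= n)%N by lia.
rewrite (addnS a k) in H *.
by have := cf_stepl cf H; have := IHk Hk; lia.
Qed.

Lemma cf_monor a b b' : (b <= b')%N -> (a + b' + 2 <= n)%N ->
  (pr a b' <= pr a b)%N /\ (pc a b' <= pc a b)%N.
Proof.
move=> bb'; rewrite -(subnKC bb'); elim: (b' - b)%N => [|k IHk] H.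
  by rewrite addn0.
have Hk : (a + (b + k) + 2 <= n)%N by lia.
rewrite (addnS b k) in H *.
by have := cf_stepr cf H; have := IHk Hk; lia.
Qed.

Lemma cf_chain a b a' b' : (a <= a')%N -> (b' <= b)%N ->
  (a + b + 2 <= n)%N -> (a' + b' + 2 <= n)%N ->
  (pr a b <= pr a' b')%N /\ (pc a b <= pc a' b')%N.
Proof.
move=> aa' bb' T T'; have T'' : (a + b' + 2 <= n)%N by lia.
by have := cf_monol aa' T'; have := cf_monor bb' T; lia.
Qed.

(** The position lies between those of the two boundary indices sharing [a] or [b], which [cf_diag]
    gives. *)
Lemma cf_bounds a b : (a + b + 2 <= n)%N ->
  [/\ (a < pr a b)%N, (pr a b + b < n)%N, (a < pc a b)%N & (pc a b + b < n)%N].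
Proof.
move=> T; have T' : (a + (n - 2 - a) + 2 = n)%N by lia.
have T'' : ((n - 2 - b) + b + 2 = n)%N by lia.
have L1 : (b <= n - 2 - a)%N by lia.
have L2 : (a <= n - 2 - b)%N by lia.
have [m1 m2] := cf_monor L1 (eq_leq T'); have [m3 m4] := cf_monol L2 (eq_leq T'').
have [e1 e2] := cf_diag cf T'; have [e3 e4] := cf_diag cf T''; split; lia.
Qed.

Lemma cf_in a b : (a + b + 2 <= n)%N -> (pr a b <= n)%N /\ (pc a b <= n)%N.
Proof. by move=> /cf_bounds[]; lia. Qed.

Section Corner.
Variable f : nat -> nat -> int.
Hypothesis fP : corner_spec n f.

(** By [cf_sum] the position advances by [a' - a] unit steps, and a corner sum grows by 0 or 1 along
    each. *)
Lemma cf_corner_stepl a a' b : (a <= a')%N -> (a' + b + 2 <= n)%N ->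
  f (pr a b) (pc a b) <= f (pr a' b) (pc a' b) <= f (pr a b) (pc a b) + (a' - a)%:Z.
Proof.
move=> aa' T'; have T : (a + b + 2 <= n)%N by lia.
have [m1 m2] := cf_monol aa' T'; have [i1 i2] := cf_in T; have [i3 i4] := cf_in T'.
have L1 : (pr a b <= pr a' b <= n)%N by rewrite m1.
have L2 : (pc a b <= pc a' b <= n)%N by rewrite m2.
have := corner_spec_lipl fP L1 i2; have := corner_spec_lipr fP i3 L2.
by have := cf_sum cf T; have := cf_sum cf T'; lia.
Qed.

Lemma cf_corner_stepr a b b' : (b <= b')%N -> (a + b' + 2 <= n)%N ->
  f (pr a b') (pc a b') <= f (pr a b) (pc a b) <= f (pr a b') (pc a b') + (b' - b)%:Z.
Proof.
move=> aa' T'; have T : (a + b + 2 <= n)%N by lia.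
have [m1 m2] := cf_monor aa' T'; have [i1 i2] := cf_in T; have [i3 i4] := cf_in T'.
have L1 : (pr a b' <= pr a b <= n)%N by rewrite m1.
have L2 : (pc a b' <= pc a b <= n)%N by rewrite m2.
have := corner_spec_lipl fP L1 i4; have := corner_spec_lipr fP i1 L2.
by have := cf_sum cf T; have := cf_sum cf T'; lia.
Qed.

End Corner.

(** The conditions of the family that [A] violates; for the family of a catalan congruence this set
    determines the class of [A]. *)
Definition cideal A : {set 'I_n * 'I_n} :=
  [set x : 'I_n * 'I_n | (x.1 + x.2 + 2 <= n)%N &&
     (x.1%:Z < corner A (pr x.1 x.2) (pc x.1 x.2))].

Lemma cideal_mono A B : (A <= B)%O -> cideal B \subset cideal A.
Proof.
move=> /asm_le_corner AB; apply/subsetP => -[a b]; rewrite !inE /= => /andP[T H].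
by have [i1 i2] := cf_in T; rewrite T; apply: lt_le_trans H (AB _ _ i1 i2).
Qed.

Definition lower_ideal (C : {set 'I_n * 'I_n}) : Prop :=
  (forall x, x \in C -> (x.1 + x.2 + 2 <= n)%N) /\
  (forall x y : 'I_n * 'I_n, (x.1 <= y.1)%N -> (x.2 <= y.2)%N -> y \in C -> x \in C).

Lemma cideal_lower A : lower_ideal (cideal A).
Proof.
split=> [x|[a b] [a' b'] /= aa' bb']; first by rewrite inE => /andP[].
rewrite !inE /= => /andP[T' H].
have T : (a + b + 2 <= n)%N by lia.
have T2 : (a' + b + 2 <= n)%N by lia.
have := cf_corner_stepl (asm_corner A) aa' T2.
have := cf_corner_stepr (asm_corner A) bb' T'; rewrite T /=; lia.
Qed.

(* The lower bound at [(i, j)] forced by a corner sum larger than [a] at the point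
   indexed by [(a, b)]. *)
Definition constr (a b i j : nat) : int :=
  a.+1%:Z - (pr a b - i)%N%:Z - (pc a b - j)%N%:Z.

Lemma constr_mono a b a' b' i j : (a <= a')%N -> (b <= b')%N -> (a' + b' + 2 <= n)%N ->
  constr a b i j <= constr a' b' i j.
Proof.
move=> aa' bb' T'; have T : (a' + b + 2 <= n)%N by lia.
have T2 : (a + b + 2 <= n)%N by lia.
have := cf_monol aa' T; have := cf_monor bb' T'.
by have := cf_sum cf T; have := cf_sum cf T2; rewrite /constr; lia.
Qed.

Lemma constr_le f a b i j : corner_spec n f -> (a + b + 2 <= n)%N ->
  (i <= n)%N -> (j <= n)%N -> a%:Z < f (pr a b) (pc a b) -> constr a b i j <= f i j.
Proof.
move=> fP T il jl H; have [i1 i2] := cf_in T; rewrite /constr.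
(* Pass through the componentwise minimum: each unit step back loses at most one, and the way up to
   [(i, j)] loses nothing. *)
set i' := minn i (pr a b); set j' := minn j (pc a b).
have L1 : (i' <= pr a b <= n)%N by lia.
have L2 : (j' <= pc a b <= n)%N by lia.
have L3 : (i' <= i <= n)%N by lia.
have L4 : (j' <= j <= n)%N by lia.
have L5 : (i' <= n)%N by lia.
have L6 : (j' <= n)%N by lia.
have := corner_spec_lipl fP L1 i2; have := corner_spec_lipr fP L5 L2.
have := corner_spec_lipl fP L3 L6; have := corner_spec_lipr fP il L4.
lia.
Qed.

(** Says that [f] is the pointwise maximum of the bounds in [l] and of the bounds 0 and [i + j - n]
    valid for all corner sums. *)
Definition constr_join (l : seq (nat * nat)) (f : nat -> nat -> int) : Prop :=
  forall i j, (i <= n)%N -> (j <= n)%N ->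
    (forall x, x \in l -> constr x.1 x.2 i j <= f i j) /\
    [\/ f i j = 0, f i j = (i + j)%:Z - n%:Z |
        exists2 x, x \in l & f i j = constr x.1 x.2 i j].

Lemma constr_join_exists (l : seq (nat * nat)) :
  (forall x, x \in l -> (x.1 + x.2 + 2 <= n)%N) ->
  exists2 f, corner_spec n f & constr_join l f.
Proof.
elim: l => [_|[a b] l IHl H].
  exists (fun i j => Num.max 0 ((i + j)%:Z - n%:Z)).
    by split=> *; rewrite /zero_one; lia.
  move=> i j il jl; split=> //.
  by case: (leP 0 ((i + j)%:Z - n%:Z)) => _; [apply: Or32|apply: Or31].
have T : (a + b + 2 <= n)%N by apply: (H (a, b)); rewrite mem_head.
have [|f fP fj] := IHl; first by move=> x xl; apply: H; rewrite inE xl orbT.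
pose g i j := Num.max (Num.max 0 ((i + j)%:Z - n%:Z)) (constr a b i j).
have gP : corner_spec n g.
  have [*] := cf_bounds T; have := cf_sum cf T.
  by split=> *; rewrite /zero_one /g /constr; lia.
exists (fun i j => Num.max (g i j) (f i j)); first exact: corner_max.
move=> i j il jl; have [f1 f2] := fj i j il jl.
have [b1 b2 _ _] := corner_spec_bounds fP il jl.
split=> [x|].
  rewrite inE => /orP[/eqP ->|/f1]; rewrite ?/g /=; lia.
have [gf|fg] := leP (g i j) (f i j).
  case: f2 => [->|->|[x xl ->]]; first exact: Or31.
    exact: Or32.
  by apply: Or33; exists x; rewrite // inE xl orbT.
apply: Or33; exists (a, b); rewrite ?mem_head // /=; move: fg; rewrite /g; lia.
Qed.

Lemma constr_join_min l f g : constr_join l f -> corner_spec n g ->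
  (forall x, x \in l -> (x.1 + x.2 + 2 <= n)%N) ->
  (forall x, x \in l -> x.1%:Z < g (pr x.1 x.2) (pc x.1 x.2)) ->
  forall i j, (i <= n)%N -> (j <= n)%N -> f i j <= g i j.
Proof.
move=> fj gP T H i j il jl; have [b1 b2 _ _] := corner_spec_bounds gP il jl.
case: (fj i j il jl) => _ [->|->|[x xl ->]] //.
by apply: constr_le => //; [apply: T|apply: H].
Qed.

(* Two points indexed by [(a, b)] and [(a', b')] with [a <= a'] and [b' <= b]
   are comparable componentwise, which settles all cases but those where one of
   the indices dominates the other. *)
Lemma constr_join_noneg l f i j : constr_join l f -> corner_spec n f ->
  (forall x, x \in l -> (x.1 + x.2 + 2 <= n)%N) -> (i < n)%N -> (j < n)%N ->
  f i.+1 j.+1 - f i.+1 j - f i j.+1 + f i j != -1.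
Proof.
move=> fj fP T il jl; apply/eqP => E.
have [_ _ d1 d2] := fP.
have := d1 i j il (ltnW jl); have := d1 i j.+1 il jl.
have := d2 i j (ltnW il) jl; have := d2 i.+1 j il jl.
rewrite /zero_one => z1 z2 z3 z4.
(* An entry -1 forces these three values; then neither universal bound is attained at [(i, j + 1)]
   or [(i + 1, j)]. *)
have e1 : f i j.+1 = f i j + 1 by lia.
have e2 : f i.+1 j = f i j + 1 by lia.
have e3 : f i.+1 j.+1 = f i j + 1 by lia.
have [b1 _ _ _] := corner_spec_bounds fP (ltnW il) (ltnW jl).
have [_ b2 _ _] := corner_spec_bounds fP il jl.
have [f1 _] := fj i j (ltnW il) (ltnW jl); have [f2 _] := fj i.+1 j.+1 il jl.
have [f3 F3] := fj i j.+1 (ltnW il) jl; have [f4 F4] := fj i.+1 j il (ltnW jl).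
case: F3 => [| |[[a b] kl /= e4]]; try lia.
case: F4 => [| |[[a' b'] k'l /= e5]]; try lia.
have := T _ kl; have := T _ k'l => /= Tl Tk.
have := f1 _ kl; have := f2 _ kl; have := f4 _ kl; rewrite /= => g1 g2 g3.
have := f1 _ k'l; have := f2 _ k'l; have := f3 _ k'l; rewrite /= => h1 h2 h3.
have mono1 := @constr_mono a b a' b' i j.+1.
have mono2 := @constr_mono a' b' a b i.+1 j.
have ch1 := @cf_chain a b a' b'.
have ch2 := @cf_chain a' b' a b.
have p1 : (j < pc a b)%N by move: g3 e4; rewrite /constr; lia.
have p2 : (pr a b <= i)%N by move: g2 e4; rewrite /constr; lia.
have p3 : (i < pr a' b')%N by move: h3 e5; rewrite /constr; lia.
have p4 : (pc a' b' <= j)%N by move: h2 e5; rewrite /constr; lia.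
have [aa'|a'a] := leqP a a'; have [bb'|b'b] := leqP b b'.
- by have := mono1 aa' bb' Tl; move: h3 e4; rewrite /constr; lia.
- by have := ch1 aa' (ltnW b'b) Tk Tl; lia.
- by have := ch2 (ltnW a'a) bb' Tl Tk; lia.
- by have := mono2 (ltnW a'a) (ltnW b'b) Tk; move: g3 e5; rewrite /constr; lia.
Qed.

(** The first position is north-east of the second, so one index dominates the other. Between them
    the corner sum may change by at most the change of [a], and this is attained only if every row
    (or column) crossed contributes; the dot of [y] (or [y']) prevents it. *)
Lemma cf_no_cross s a b a' b' (y y' : 'I_n) :
  (a + b + 2 <= n)%N -> (a' + b' + 2 <= n)%N ->
  corner (asm_perm s) (pr a b) (pc a b) - a%:Z =
    corner (asm_perm s) (pr a' b') (pc a' b') - a'%:Z ->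
  (pr a b <= y < pr a' b')%N -> (pc a' b' <= s y)%N ->
  (pc a' b' <= s y' < pc a b)%N -> (pr a b <= y')%N -> False.
Proof.
move=> T T' E /andP[y1 y2] y3 /andP[y4 y5] y6.
have [i1 i2] := cf_in T; have [i3 i4] := cf_in T'.
have fP := asm_corner (asm_perm s); set f := corner (asm_perm s) in fP E.
have [aa'|a'a] := leqP a a'; have [bb'|b'b] := leqP b b'.
- have L1 : (pr a b <= y <= n)%N by lia.
  have L2 : (y < pr a' b' <= n)%N by lia.
  have L3 : (pc a' b' <= pc a b <= n)%N by lia.
  have := corner_spec_lipl fP L1 i4; have := corner_spec_lipl fP L2 i4.
  have := corner_spec_lipr fP i1 L3; rewrite /f corner_permS -/f.
  have T2 : (a' + b + 2 <= n)%N by lia.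
  have := cf_monol aa' T2; have := cf_monor bb' T'.
  have := cf_sum cf T; have := cf_sum cf T'; have := cf_sum cf T2; lia.
- have := cf_chain aa' (ltnW b'b) T T'; lia.
- have := cf_chain (ltnW a'a) bb' T' T; lia.
- have L1 : (pc a' b' <= s y' <= n)%N by lia.
  have L2 : (s y' < pc a b <= n)%N by lia.
  have L3 : (pr a b <= pr a' b' <= n)%N by lia.
  have := corner_spec_lipr fP i1 L1; have := corner_spec_lipr fP i1 L2.
  have := corner_spec_lipl fP L3 i4; rewrite /f corner_perm_colS -/f.
  have T2 : (a + b' + 2 <= n)%N by lia.
  have := cf_monol (ltnW a'a) T2; have := cf_monor (ltnW b'b) T.
  have := cf_sum cf T; have := cf_sum cf T'; have := cf_sum cf T2; lia.
Qed.

End Family.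

(** * Pattern occurrences, and matrices without entry -1 *)

Lemma contains_pattern321P n (s : 'S_n) : reflect
  (exists x y z : 'I_n, [/\ (x < y)%N, (y < z)%N, (s y < s x)%N & (s z < s y)%N])
  (contains_pattern s [:: 3; 2; 1]%N).
Proof.
apply: (iffP existsP) => [[g /forallP H]|[x [y [z [xy yz yx zy]]]]].
  have G (a b : 'I_3) : (a < b)%N -> (g a < g b)%N &&
      ((s (g a) < s (g b))%N == (nth 0 [:: 3; 2; 1] a < nth 0 [:: 3; 2; 1] b)%N).
    by move=> ab; have /forallP/(_ b)/implyP/(_ ab) := H a.
  have lt_of (u v : 'I_n) : (u < v)%N -> ~~ (s u < s v)%N -> (s v < s u)%N.
    move=> uv; rewrite -leqNgt leq_eqVlt => /orP[/eqP/val_inj/perm_inj e|//].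
    by move: uv; rewrite e ltnn.
  exists (g ord0), (g (inord 1)), (g (inord 2)).
  have /andP[g01 /eqP s01] : _ := G ord0 (inord 1) ltac:(by rewrite inordK).
  have /andP[g12 /eqP s12] : _ := G (inord 1) (inord 2) ltac:(by rewrite !inordK).
  by split=> //; apply: lt_of; rewrite ?s01 ?s12 ?inordK.
exists [ffun k : 'I_3 => nth x [:: x; y; z] k].
apply/forallP => -[[|[|[|//]]] ka]; apply/forallP => -[[|[|[|//]]] kb];
  by apply/implyP => //= _; rewrite !ffunE /=; lia.
Qed.

Lemma contains_pattern3412 n (s : 'S_n) : contains_pattern s [:: 3; 4; 1; 2]%N ->
  exists x y z w : 'I_n, [/\ (x < y)%N, (y < z)%N, (z < w)%N &
    [/\ (s x < s y)%N, (s z < s w)%N & (s w <= s x)%N]].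
Proof.
move=> /existsP[g /forallP H].
have G (a b : 'I_4) : (a < b)%N -> (g a < g b)%N &&
    ((s (g a) < s (g b))%N == (nth 0 [:: 3; 4; 1; 2] a < nth 0 [:: 3; 4; 1; 2] b)%N).
  by move=> ab; have /forallP/(_ b)/implyP/(_ ab) := H a.
have /andP[g01 /eqP s01] : _ := G ord0 (inord 1) ltac:(by rewrite inordK).
have /andP[g12 _] : _ := G (inord 1) (inord 2) ltac:(by rewrite !inordK).
have /andP[g23 /eqP s23] : _ := G (inord 2) (inord 3) ltac:(by rewrite !inordK).
have /andP[g03 /eqP s03] : _ := G ord0 (inord 3) ltac:(by rewrite !inordK).
exists (g ord0), (g (inord 1)), (g (inord 2)), (g (inord 3)); split=> //.
split; [rewrite s01|rewrite s23|rewrite leqNgt s03]; by rewrite !inordK.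
Qed.

Lemma asm_is_perm n (A : asm n) :
  (forall i j, A i j != -1) -> exists s : 'S_n, A = asm_perm s.
Proof.
move=> A1; have /is_asmP[r c] : is_asm A by case: A {A1}.
have A01 i j : A i j = 0 \/ A i j = 1.
  by have [/(_ j)] := r i; have := A1 i j; rewrite !inE; lia.
have A0 i j : 0 <= A i j by have := A01 i j; lia.
have ex i : exists j, A i j == 1.
  have [_ ri _] := r i.
  have [/existsP//|/existsPn H] := boolP [exists j, A i j == 1].
  move: ri; rewrite big1 // => j _; have := A01 i j; have := H j; lia.
pose s i := xchoose (ex i).
have sP i : A i (s i) = 1 by exact/eqP/(xchooseP (ex i)).
have s_inj : injective s.
  move=> i i' e; apply/eqP/negPn/negP => ii'; have [_ + _] := c (s i).
  rewrite (bigD1 i) //= (bigD1 i') 1?eq_sym //= sP e sP; set S := bigop _ _ _.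
  have : 0 <= S by apply: sumr_ge0.
  lia.
exists (perm s_inj); apply: val_inj; apply/matrixP => i j.
rewrite !mxE permE; case: eqP => [<-|/eqP sj]; first by rewrite sP.
have [_ + _] := r i; rewrite (bigD1 (s i)) //= (bigD1 j) 1?eq_sym //= sP; set S := bigop _ _ _.
have : 0 <= S by apply: sumr_ge0.
by have := A0 i j; rewrite mulr0n; lia.
Qed.

(** * The greatest matrix of a class *)

Section MaximalPermutation.
Variables (n : nat) (pr pc : nat -> nat -> nat).
Hypothesis cf : catalan_family n pr pc.
Implicit Types (A B : asm n) (s t : 'S_n).
Local Notation cideal := (cideal pr pc).

Lemma lower_ideal_perm (C : {set 'I_n * 'I_n}) : lower_ideal C ->
  exists s, [/\ covexillary s, cideal (asm_perm s) = C &
    forall B, C \subset cideal B -> (B <= asm_perm s)%O].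
Proof.
move=> [CT Cdown]; pose l := [seq (val x.1, val x.2) | x <- enum C].
have lP x : x \in l -> exists2 y, y \in C & x = (val y.1, val y.2).
  by case/mapP => y; rewrite mem_enum => yC ->; exists y.
have Cl x : x \in C -> (val x.1, val x.2) \in l.
  by move=> xC; apply/mapP; exists x; rewrite ?mem_enum.
have lT x : x \in l -> (x.1 + x.2 + 2 <= n)%N by case/lP => y /CT + ->.
have [f fP fj] := constr_join_exists cf lT.
pose A := Asm (of_corner_asm fP).
have Af i j : (i <= n)%N -> (j <= n)%N -> corner A i j = f i j.
  by move=> il jl; apply: corner_of_corner.
have [i j|s sA] := @asm_is_perm n A.
  by rewrite mxE; apply: (constr_join_noneg cf fj fP lT); apply: ltn_ord.
have sf i j : (i <= n)%N -> (j <= n)%N -> corner (asm_perm s) i j = f i j.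
  by rewrite -sA; apply: Af.
have minf B : (forall x, x \in C -> x.1%:Z < corner B (pr x.1 x.2) (pc x.1 x.2)) ->
    forall i j, (i <= n)%N -> (j <= n)%N -> f i j <= corner B i j.
  move=> H; apply: (constr_join_min cf fj (asm_corner B) lT).
  by move=> x /lP[y yC ->]; apply: H.
have Cs x : x \in C -> x.1%:Z < corner (asm_perm s) (pr x.1 x.2) (pc x.1 x.2).
  move=> xC; have T := CT x xC; have [i1 i2] := cf_in cf T.
  have [/(_ _ (Cl x xC)) + _] := fj _ _ i1 i2.
  by rewrite sf // /constr /=; lia.
exists s; split.
- apply/negP => /contains_pattern3412[x [y [z [w [xy yz zw [sxy szw swx]]]]]].
  (* Exchanging the values of a non-inversion lowers corner sums on its box, so by minimality of [f]
     some condition of [C] breaks there; it was satisfied with no slack. *)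
  have swap (p q : 'I_n) : (p < q)%N -> (s p < s q)%N -> exists2 k, k \in C &
      [/\ (p < pr k.1 k.2 <= q)%N, (s p < pc k.1 k.2 <= s q)%N &
          corner (asm_perm s) (pr k.1 k.2) (pc k.1 k.2) = k.1.+1%:Z].
    move=> pq spq; pose t := (tperm p q * s)%g.
    have tE : (tperm p q * t)%g = s by rewrite mulgA tperm2 mul1g.
    have tp : t p = s q by rewrite permM tpermL.
    have tq : t q = s p by rewrite permM tpermR.
    have tc i j := @corner_tperm n t p q i j pq; rewrite tp tq in tc.
    rewrite tE in tc.
    have [/existsP[k /andP[kC kt]]|/existsPn N] := boolP [exists k, (k \in C) &&
        (corner (asm_perm t) (pr k.1 k.2) (pc k.1 k.2) <= k.1%:Z)].
      exists k => //; have := Cs k kC; rewrite tc //; split; lia.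
    have M k : k \in C -> k.1%:Z < corner (asm_perm t) (pr k.1 k.2) (pc k.1 k.2).
      by move=> kC; have := N k; rewrite kC /=; lia.
    have := minf _ M p.+1 (s p).+1 (ltn_ord p) (ltn_ord (s p)).
    rewrite -sf ?ltn_ord // tc //; lia.
  (* The ascents 34 and 12 of the pattern yield two positions of excess one, placed as [cf_no_cross]
     forbids. *)
  have [[a b] kC] := swap _ _ xy sxy; have [[a' b'] k'C] := swap _ _ zw szw.
  rewrite /= => -[q1 q2 q3] [q4 q5 q6].
  have := CT _ kC; have := CT _ k'C; rewrite /= => T' T.
  apply: (@cf_no_cross n pr pc cf s a b a' b' y w) => //.
  + by rewrite q3 q6; lia.
  + lia.
  + lia.
  + lia.
  + lia.
- apply/setP => -[a b]; apply/idP/idP => [|xC]; last first.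
    by rewrite inE (CT _ xC); apply: Cs.
  rewrite inE /= => /andP[T]; have [i1 i2] := cf_in cf T; rewrite sf //.
  have [_ []] := fj _ _ i1 i2; have := cf_sum cf T; try (move=> ? ->; lia).
  (* A bound of index [(a', b')] exceeding [a] at the position of [(a, b)] forces [a <= a'] and
     [b <= b']. *)
  move=> S1 [_ /lP[[a' b'] yC ->] ->]; rewrite /constr /= => H.
  have := CT _ yC; rewrite /= => T'; have S2 := cf_sum cf T'.
  by apply: Cdown yC => /=; lia.
- move=> B /subsetP CB; apply/asm_leP => i j il jl; rewrite sf //.
  by apply: minf => // x /CB; rewrite inE => /andP[].
Qed.

End MaximalPermutation.
(** * Inversions and active points *)

(** Upward jumps are harmless: the first nonpositive value is reached from a positive one by a drop
    of at most one. *)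
Lemma int_ivt (g : nat -> int) N : 0 <= g 0%N -> g N <= 0 ->
  (forall t, (t < N)%N -> g t - 1 <= g t.+1) -> exists2 t, (t <= N)%N & g t = 0.
Proof.
elim: N => [|N IHN] g0 gN gS; first by exists 0%N => //; lia.
have [gN0|gN0] := leP (g N) 0.
  have [|t tN gt] := IHN g0 gN0; first by move=> t tN; apply: gS; lia.
  by exists t => //; lia.
by exists N.+1 => //; have := gS N (ltnSn N); lia.
Qed.

Lemma corner_perm_lt_row n (s : 'S_n) (p : 'I_n) i j : (p < i <= n)%N -> (j <= s p)%N ->
  corner (asm_perm s) i j < i%:Z.
Proof.
move=> ip js; have jn : (j <= n)%N by have := ltn_ord (s p); lia.
have := corner_spec_lipl (asm_corner (asm_perm s)) ip jn.
rewrite corner_permS; have pn : (p <= n)%N by lia.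
by have [_ _ + _] := corner_spec_bounds (asm_corner (asm_perm s)) pn jn; lia.
Qed.

Lemma corner_perm_lt_col n (s : 'S_n) (p : 'I_n) i j : (s p < j <= n)%N -> (i <= p)%N ->
  corner (asm_perm s) i j < j%:Z.
Proof.
move=> js ip; have il : (i <= n)%N by have := ltn_ord p; lia.
have := corner_spec_lipr (asm_corner (asm_perm s)) il js.
rewrite corner_perm_colS; have pn : (s p <= n)%N by lia.
by have [_ _ _] := corner_spec_bounds (asm_corner (asm_perm s)) il pn; lia.
Qed.

Section Inversions.
Variables (n : nat) (pr pc : nat -> nat -> nat).
Hypothesis cf : catalan_family n pr pc.
Implicit Types (A B : asm n) (s t : 'S_n).
Local Notation cideal := (cideal pr pc).

Definition active s a b : Prop :=
  (a + b + 2 <= n)%N /\ corner (asm_perm s) (pr a b) (pc a b) = a%:Z.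

(* With [U] and [V] the numbers of dots north-west and south-east of the dot
   [(y, s y)], the excess of the corner sum over [a] falls by at most one at each
   step of the zigzag [(a, b), (a + 1, b), (a + 1, b + 1), ...] through [(U, V)];
   this zigzag only visits positions on two antidiagonals next to the dot. *)
Lemma active_exists s (x y z : 'I_n) : (x < y)%N -> (y < z)%N ->
    (s y < s x)%N -> (s z < s y)%N ->
  exists a b, active s a b /\
    ((pr a b <= y)%N /\ (s y < pc a b)%N \/ (y < pr a b)%N /\ (pc a b <= s y)%N).
Proof.
move=> xy yz yx zy; have fP := asm_corner (asm_perm s).
have yn : (y <= n)%N := ltnW (ltn_ord y).
have vn : (s y <= n)%N := ltnW (ltn_ord (s y)).
have [U Ue] : exists U : nat, corner (asm_perm s) y (s y) = U%:Z.
  by eexists; apply: corner_perm.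
have Uy : (U < y)%N.
  by have := @corner_perm_lt_row n s x y (s y); rewrite Ue xy yn; lia.
have Uv : (U < s y)%N.
  by have := @corner_perm_lt_col n s z y (s y); rewrite Ue zy vn; lia.
have c1 : corner (asm_perm s) y.+1 (s y) = U%:Z by rewrite corner_permS ltnn addr0.
have c2 : corner (asm_perm s) y (s y).+1 = U%:Z by rewrite corner_perm_colS ltnn addr0.
have c3 : corner (asm_perm s) y.+1 (s y).+1 = U.+1%:Z.
  by rewrite corner_permS c2 ltnSn; lia.
have [_ b2 _ _] := corner_spec_bounds fP (ltn_ord y) (ltn_ord (s y)).
have [V VE] : exists V, (U + n = V + y + s y + 1)%N.
  by exists (U + n - y - s y - 1)%N; move: b2; rewrite c3; lia.
have UV : (U + V + 3 <= n)%N by lia.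
(* The zigzag starts with [a] or [b] zero, meets [(U, V)] at time [2 * m] and reaches the boundary
   [a + b + 2 = n] at time [N]. *)
pose m := minn U V; pose N := (n - 2 - (U + V - 2 * m))%N.
pose a (t : nat) := (U - m + uphalf t)%N; pose b (t : nat) := (V - m + t./2)%N.
have T (t : nat) : (t <= N)%N -> (a t + b t + 2 <= n)%N by rewrite /a /b /N /m; lia.
pose e (t : nat) : int := corner (asm_perm s) (pr (a t) (b t)) (pc (a t) (b t)) - (a t)%:Z.
have ab0 : a 0%N = 0%N \/ b 0%N = 0%N by rewrite /a /b /m; lia.
have [||t tN|t tN et] := @int_ivt e N.
- have T0 := T 0%N (leq0n N); have [i1 i2] := cf_in cf T0.
  have [p1 p2 _ _] := corner_spec_bounds fP i1 i2; have := cf_sum cf T0.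
  by rewrite /e; case: ab0; lia.
- have TN := T N (leqnn N); have [i1 i2] := cf_in cf TN.
  have TN' : (a N + b N + 2 = n)%N by rewrite /a /b /N /m; lia.
  have [d1 d2] := cf_diag cf TN'.
  have [_ _ p3 _] := corner_spec_bounds fP i1 i2.
  rewrite /e d1 d2 in i1 i2 p3 *; set k := (a N).+1 in i1 i2 p3 *.
  suff : corner (asm_perm s) k k < k%:Z by rewrite /k; lia.
  (* The final position [(k, k)] is so close to the dot of [y] that either this dot or, if [k] is
     [y + 1] and [s y + 1], the dot of [x] is missed by the corner. *)
  have k1 : (y + s y + 1 <= 2 * k <= y + s y + 2)%N.
    by move: VE TN'; rewrite /k /a /b; lia.
  have [ky|yk] := leqP k y.
    by apply: (@corner_perm_lt_col _ _ y); lia.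
  have [kv|vk] := leqP k (s y).
    by apply: (@corner_perm_lt_row _ _ y); lia.
  by apply: (@corner_perm_lt_row _ _ x); lia.
- have [to|te] := boolP (odd t).
    have -> : e t.+1 = corner (asm_perm s) (pr (a t) (b t).+1) (pc (a t) (b t).+1) - (a t)%:Z.
      have -> : (b t).+1 = b t.+1 by rewrite /b; lia.
      by have -> : a t = a t.+1 by rewrite /a; lia.
    have T' : (a t + (b t).+1 + 2 <= n)%N by have := T _ tN; rewrite /a /b; lia.
    by have := cf_corner_stepr cf fP (leqnSn (b t)) T'; rewrite /e; lia.
  have -> : e t.+1 = corner (asm_perm s) (pr (a t).+1 (b t)) (pc (a t).+1 (b t)) - (a t).+1%:Z.
    have -> : b t = b t.+1 by rewrite /b; lia.
    by have -> : (a t).+1 = a t.+1 by rewrite /a; lia.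
  have T' : ((a t).+1 + b t + 2 <= n)%N by have := T _ tN; rewrite /a /b; lia.
  by have := cf_corner_stepl cf fP (leqnSn (a t)) T'; rewrite /e; lia.
have Tt := T t tN; have St := cf_sum cf Tt.
have Dt : (y + s y + 1 <= pr (a t) (b t) + pc (a t) (b t) <= y + s y + 2)%N.
  by move: VE St; rewrite /a /b /m; lia.
(* On these antidiagonals only [(y + 1, s y + 1)] lies in neither quadrant. There the index is
   [(U + 1, V)], and its predecessor [(U, V)] serves instead. *)
have [/andP[/eqP E1 /eqP E2]|ne] :=
    boolP ((pr (a t) (b t) == y.+1) && (pc (a t) (b t) == (s y).+1)); last first.
  exists (a t), (b t); split; first by split=> //; move: et; rewrite /e; lia.
  by lia.
have aU : a t = U.+1 by move: et; rewrite /e E1 E2 c3; lia.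
have bV : b t = V by move: St; rewrite E1 E2 aU; lia.
rewrite aU bV in Tt St E1 E2.
have TU : (U + V + 2 <= n)%N by lia.
have SU := cf_sum cf TU; have := cf_monol cf (leqnSn U) Tt.
exists U, V; split; last by lia.
split=> //.
have [[-> ->]|[-> ->]] : (pr U V = y :> nat /\ pc U V = (s y).+1) \/
   (pr U V = y.+1 /\ pc U V = s y :> nat) by lia.
- exact: c2.
- exact: c1.
Qed.

(** At an active point the corner sum [a] is below both coordinates, so by pigeonhole the outer
    letter can be replaced by one whose box with [y] encloses the point. *)
Lemma inversion_active s : contains_pattern s [:: 3; 2; 1]%N ->
  exists x y z : 'I_n, [/\ (x < y)%N, (y < z)%N, (s y < s x)%N, (s z < s y)%N &
    exists a b, active s a b /\
     ((x < pr a b <= y)%N && (s y < pc a b <= s x)%N \/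
      (y < pr a b <= z)%N && (s z < pc a b <= s y)%N)].
Proof.
move=> /contains_pattern321P[x [y [z [xy yz yx zy]]]].
have [a [b [[T E] H]]] := active_exists xy yz yx zy.
have [b1 _ b2 _] := cf_bounds cf T; have [i1 i2] := cf_in cf T.
case: H => -[h1 h2].
  have [|x' x'a x'b] := @corner_perm_gap n s (pr a b) (pc a b) i1; first by rewrite E.
  exists x', y, z; split=> //; try lia.
  by exists a, b; split=> //; left; lia.
have [|z' z'a z'b] := @corner_perm_gap_col n s (pr a b) (pc a b) i2; first by rewrite E.
exists x, y, z'; split=> //; try lia.
by exists a, b; split=> //; right; lia.
Qed.

(** Corner sums rise by at most one, so only a condition met with equality can become violated. *)
Lemma cideal_tperm_eq s (x y : 'I_n) : (x < y)%N -> (s y < s x)%N ->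
    (forall a b, active s a b -> ~ (x < pr a b <= y)%N && (s y < pc a b <= s x)%N) ->
  cideal (asm_perm (tperm x y * s)%g) = cideal (asm_perm s).
Proof.
move=> xy yx H; apply/setP => -[a b]; rewrite !inE /=.
case T: (a + b + 2 <= n)%N => //=; rewrite corner_tperm //.
have [E|E] := eqVneq (corner (asm_perm s) (pr a b) (pc a b)) a%:Z; last first.
  by move: E => /=; lia.
by have /negP/negPf-> := H a b (conj T E); rewrite addr0.
Qed.

Lemma cideal_tperm_lt s (x y : 'I_n) a b : (x < y)%N -> (s y < s x)%N ->
    active s a b -> (x < pr a b <= y)%N && (s y < pc a b <= s x)%N ->
  (#|cideal (asm_perm s)| < #|cideal (asm_perm (tperm x y * s)%g)|)%N.
Proof.
move=> xy yx [T E] H; apply/proper_card/properP.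
split; first exact/(cideal_mono cf)/tperm_le.
have an : (a < n)%N by lia.
have bn : (b < n)%N by lia.
exists (Ordinal an, Ordinal bn); rewrite !inE /= T /=.
  by rewrite corner_tperm // H E; lia.
by rewrite E ltxx.
Qed.

End Inversions.
(** * Temperley-Lieb relations and independence of the 321-avoiding permutations *)

Section TemperleyLiebRelations.
Variables (F : fieldType) (n : nat).
Implicit Types (s t : 'S_n) (x y z : 'I_n).
Local Notation tlp := (@tl_perm F n).
Local Notation GA := (group_algebra F 'S_n).

Lemma tl_perm_relation s x y z : (x < y)%N -> (y < z)%N ->
  tlp s = tlp (tperm x y * s)%g + tlp (tperm y z * s)%g + tlp (tperm x z * s)%g
          - tlp (tperm x y * tperm x z * s)%g - tlp (tperm x z * tperm x y * s)%g.
Proof.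
move=> xy yz; have gI : tl_gen F x y z * ga_of F s \in tl_ideal F n.
  apply/tl_idealMr/tl_gens_ideal/mapP; exists (x, y, z) => //.
  by rewrite mem_filter /= xy yz mem_enum.
have /tl_projP : tl_gen F x y z * ga_of F s - 0 \in tl_ideal F n by rewrite subr0.
rewrite /tl_gen !(mulrDl, mulNr) -!ga_ofM mul1g !(raddfD, raddfN, raddf0) /=.
rewrite -/(tl_perm F _) -!/(tl_perm F _) => E.
apply/eqP; rewrite -subr_eq0 -[X in _ == X]E; apply/eqP.
rewrite !opprD !opprK -!addrA; congr (_ + _).
Qed.

Lemma ga_of_sum (a : GA) : a = \sum_s a s *: ga_of F s.
Proof.
apply/ffunP => t; rewrite sum_ffunE (bigD1 t) //= !ffunE eqxx.
rewrite big1 ?addr0 => [|s /negPf st]; first by rewrite /GRing.scale /= mulr1.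
by rewrite !ffunE eq_sym st scaler0.
Qed.

Lemma tl_span_perms (U : {vspace tl F n}) : (forall s, tlp s \in U) -> U = fullv.
Proof.
move=> H; apply/eqP; rewrite eqEsubv subvf; apply/subvP.
elim/tl_ind => a _; rewrite [a]ga_of_sum raddf_sum; apply: memv_suml => s _.
by rewrite /= tl_projZ memvZ // H.
Qed.

Section SetFunctional.
Implicit Types E G : {set 'I_n}.

(* The matrix coefficient of the action of the symmetric group on the tensor
   power of a plane, between the two basis vectors given by [E] and [G]. *)
Definition set_coef E G (a : GA) : F := \sum_(t : 'S_n | t @: E == G) a t.

Lemma set_coef_of E G s : set_coef E G (ga_of F s) = (s @: E == G)%:R.
Proof.
rewrite /set_coef; case: eqP => [sE|sE].
  rewrite (bigD1 s) ?sE //= ffunE eqxx big1 ?addr0 // => t /andP[_ /negPf ts].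
  by rewrite ffunE ts.
by rewrite big1 // => t /eqP tE; rewrite ffunE; case: eqP => // ts; rewrite ts in tE.
Qed.

Lemma imset_permM s t E : (s * t)%g @: E = t @: (s @: E).
Proof. by rewrite -imset_comp; apply: eq_imset => x; rewrite /= permM. Qed.

Lemma set_coefMl E G a b : set_coef E G (a * b) = \sum_s a s * set_coef (s @: E) G b.
Proof.
rewrite /set_coef; under eq_bigr => t _ do rewrite ffunE.
rewrite exchange_big; apply: eq_bigr => s _ /=; rewrite mulr_sumr.
rewrite (reindex_inj (mulgI s)) /=; apply: eq_big => t; first by rewrite imset_permM.
by rewrite mulKg.
Qed.

Lemma set_coefMr E G a b :
  set_coef E G (a * b) = \sum_t b t * set_coef E ((t^-1)%g @: G) a.
Proof.
rewrite set_coefMl /set_coef.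
under eq_bigr => s _ do rewrite mulr_sumr big_mkcond /=.
rewrite exchange_big; apply: eq_bigr => t _ /=; rewrite mulr_sumr [RHS]big_mkcond.
apply: eq_bigr => s _; rewrite -(inj_eq (imset_inj (@perm_inj _ t^-1)%g)).
by rewrite -imset_permM mulgV imset_perm1; case: ifP; rewrite // mulrC.
Qed.

Lemma tperm_imset x y E : (x \in E) = (y \in E) -> tperm x y @: E = E.
Proof.
move=> xyE; apply/eqP; rewrite eqEcard card_imset ?leqnn ?andbT; last exact: perm_inj.
by apply/subsetP => _ /imsetP[u uE ->]; case: tpermP => [e|e|//]; [rewrite -xyE -e|rewrite xyE -e].
Qed.

(** Two of the three points agree on membership in [E]. Their transposition fixes [E], and pulling
    it out on the left pairs the six terms with opposite signs. *)
Lemma set_coef_gen E G x y z : (x < y)%N -> (y < z)%N ->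
  set_coef E G (tl_gen F x y z) = 0.
Proof.
move=> xy yz; have [nxy nyz nxz] : [/\ x != y, y != z & x != z].
  by split; rewrite -val_eqE /=; lia.
have set_coefN a : set_coef E G (- a) = - set_coef E G a.
  by rewrite /set_coef -sumrN; apply: eq_bigr => t _; rewrite !ffunE.
have set_coefD a b : set_coef E G (a + b) = set_coef E G a + set_coef E G b.
  by rewrite /set_coef -big_split; apply: eq_bigr => t _; rewrite !ffunE.
rewrite /tl_gen !(set_coefD, set_coefN) !set_coef_of imset_perm1.
have e1 : (tperm x y * tperm x z = tperm y z * tperm x y)%g.
  by rewrite [RHS]conjgC tpermJ tpermR tpermD.
have e2 : (tperm x y * tperm x z = tperm x z * tperm y z)%g.
  by rewrite conjgC tpermJ tpermL tpermD ?(eq_sym z) // (tpermC z).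
have e3 : (tperm x z * tperm x y = tperm x y * tperm y z)%g.
  by rewrite conjgC tpermJ tpermL tpermD ?(eq_sym z).
have e4 : (tperm x z * tperm x y = tperm y z * tperm x z)%g.
  by rewrite [RHS]conjgC tpermJ tpermR tpermD ?(eq_sym z) // (tpermC y).
have : [|| (x \in E) == (y \in E), (x \in E) == (z \in E) | (y \in E) == (z \in E)].
  by case: (x \in E); case: (y \in E); case: (z \in E).
case/or3P => /eqP/tperm_imset H.
- by rewrite e3 !imset_permM H; ring.
- by rewrite e2 !imset_permM H; ring.
- by rewrite e1 e4 !imset_permM H; ring.
Qed.

(** Bundles all coefficients, so that their common zeros form a kernel to which [tl_ideal_min]
    applies. *)
Definition set_coefs (a : GA) : {ffun {set 'I_n} * {set 'I_n} -> F^o} :=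
  [ffun p => set_coef p.1 p.2 a].

Lemma set_coefs_is_linear : linear set_coefs.
Proof.
move=> k a b; apply/ffunP => p; rewrite !ffunE /set_coef scaler_sumr -big_split.
by apply: eq_bigr => t _; rewrite !ffunE.
Qed.
HB.instance Definition _ := GRing.isLinear.Build F GA
  {ffun {set 'I_n} * {set 'I_n} -> F^o} *:%R set_coefs set_coefs_is_linear.

Lemma set_coef_tl_ideal E G a : a \in tl_ideal F n -> set_coef E G a = 0.
Proof.
have kerP b : reflect (forall E G, set_coef E G b = 0) (b \in lker (linfun set_coefs)).
  rewrite memv_ker lfunE; apply: (iffP eqP) => [/ffunP H E' G'|H].
    by have := H (E', G'); rewrite !ffunE.
  by apply/ffunP => p; rewrite !ffunE.
move=> aI; apply: (kerP a _); move: a aI; apply/subvP/tl_ideal_min.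
- move=> a x /kerP H; apply/kerP => E' G'; rewrite set_coefMl big1 // => s _.
  by rewrite H mulr0.
- move=> a x /kerP H; apply/kerP => E' G'; rewrite set_coefMr big1 // => s _.
  by rewrite H mulr0.
- move=> g /mapP[[[x y] z]]; rewrite mem_filter => /andP[/andP[/= xy yz] _] ->.
  by apply/kerP => E' G'; apply: set_coef_gen.
Qed.

(** A 321-avoiding permutation is increasing on this set and on its complement. *)
Definition inv_tops s : {set 'I_n} :=
  [set i : 'I_n | [exists j : 'I_n, (i < j)%N && (s j < s i)%N]].

(** As [s] increases on [E], one of the conditions on [p] and on [s p] implies the other there, so
    the intersection is as large as the two sizes allow; these depend only on [E] and its image. *)
Lemma perm_increasing_card s t E i j :
    (forall p q, p \in E -> q \in E -> (p < q)%N -> (s p < s q)%N) -> t @: E = s @: E ->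
  (#|E :&: [set p : 'I_n | (p < i)%N && (t p < j)%N]| <=
   #|E :&: [set p : 'I_n | (p < i)%N && (s p < j)%N]|)%N.
Proof.
move=> inc tE; pose A := E :&: [set p : 'I_n | (p < i)%N].
pose B (u : 'S_n) := E :&: [set p : 'I_n | (u p < j)%N].
have AB (u : 'S_n) : E :&: [set p : 'I_n | (p < i)%N && (u p < j)%N] = A :&: B u.
  by apply/setP => p; rewrite !inE; case: (p \in E).
have cB (u : 'S_n) : #|B u| = #|u @: E :&: [set p : 'I_n | (p < j)%N]|.
  rewrite -(card_imset _ (@perm_inj _ u)); apply: eq_card => p.
  apply/imsetP/setIP => [[q]|[/imsetP[q qE ->]]]; rewrite !inE.
    by case/andP=> qE uq ->; rewrite imset_f.
  by move=> uq; exists q; rewrite // !inE qE.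
rewrite !AB; have [AsB|/subsetPn[p pA npB]] := boolP (A \subset B s).
  by rewrite (setIidPl AsB) subset_leq_card // subsetIl.
suff /setIidPr -> : B s \subset A by rewrite cB -tE -cB subset_leq_card // subsetIr.
apply/subsetP => q; move: pA npB; rewrite !inE => /andP[pE pi]; rewrite pE /= -leqNgt.
move=> jp /andP[qE qj]; rewrite qE /= (leq_ltn_trans _ pi) // leqNgt.
by apply/negP => pq; have := inc p q pE qE pq; lia.
Qed.

Lemma avoids321_le s t : avoids s [:: 3; 2; 1]%N ->
  t @: inv_tops s = s @: inv_tops s -> (asm_perm s <= asm_perm t)%O.
Proof.
move=> /contains_pattern321P av tE; set E := inv_tops s in tE.
have le_of (p q : 'I_n) : (p < q)%N -> (s q < s p)%N = false -> (s p < s q)%N.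
  move=> pq /negbT; rewrite -leqNgt leq_eqVlt => /orP[/eqP/val_inj/perm_inj e|//].
  by move: pq; rewrite e ltnn.
have incE p q : p \in E -> q \in E -> (p < q)%N -> (s p < s q)%N.
  rewrite !inE => _ /existsP[r /andP[qr sr]] pq; apply: le_of => //.
  by apply/negP => sqp; apply: av; exists p, q, r.
have incE' p q : p \in ~: E -> q \in ~: E -> (p < q)%N -> (s p < s q)%N.
  rewrite !inE => /existsPn/(_ q) pq _ lpq; apply: le_of => //.
  by move: pq; rewrite lpq /= => /negPf.
have tE' : t @: (~: E) = s @: (~: E).
  apply/setP => p; rewrite -[p](permKV t) mem_imset; last exact: perm_inj.
  rewrite inE -(mem_imset _ _ (@perm_inj _ t)) tE permKV.
  by rewrite -[p](permKV s) !mem_imset ?inE //; exact: perm_inj.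
apply/asm_leP => i j _ _; rewrite !corner_perm lez_nat.
rewrite -(cardsID E) -[X in (_ <= X)%N](cardsID E) ![_ :&: E]setIC !setDE ![_ :&: ~: E]setIC.
by apply: leq_add; apply: perm_increasing_card.
Qed.

(** Triangularity: take [w i] of largest rank with nonzero coefficient. Any other [w j] with the
    same image of [inv_tops (w i)] is strictly above it, so that matrix coefficient isolates
    [k i]. *)
Lemma tl_avoids321_free m (w : 'I_m -> 'S_n) (k : 'I_m -> F) : injective w ->
    (forall i, avoids (w i) [:: 3; 2; 1]%N) ->
  \sum_i k i *: tlp (w i) = 0 -> forall i, k i = 0.
Proof.
move=> w_inj av k0.
have aI : \sum_i k i *: ga_of F (w i) \in tl_ideal F n.
  rewrite -[X in X \in _]subr0; apply/tl_projP; rewrite raddf0 raddf_sum -[RHS]k0.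
  by apply: eq_bigr => i _; rewrite /= tl_projZ.
have coef E G : \sum_i k i * (w i @: E == G)%:R = 0.
  have : set_coefs (\sum_i k i *: ga_of F (w i)) (E, G) = 0.
    by rewrite ffunE set_coef_tl_ideal.
  rewrite linear_sum sum_ffunE => H; rewrite -[RHS]H.
  transitivity (\sum_i set_coefs (k i *: ga_of F (w i)) (E, G) : F); last by [].
  by apply: eq_bigr => i _; rewrite linearZ !ffunE set_coef_of.
have [/forallP H i|/forallPn[i0 ki0]] := boolP [forall i, k i == 0]; first exact/eqP.
have [i ki imax] := @arg_maxnP _ i0 (fun i => k i != 0) (fun i => asm_ht (asm_perm (w i))) ki0.
have := coef (inv_tops (w i)) (w i @: inv_tops (w i)).
rewrite (bigD1 i) //= eqxx mulr1 big1 => [|j ji]; first by rewrite addr0 => kz;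
  rewrite kz eqxx in ki.
case: eqP => [wj|]; last by rewrite mulr0.
have [->|kj] := eqVneq (k j) 0; first by rewrite mul0r.
have := asm_ht_lt (avoids321_le (av i) wj); rewrite (inj_eq (@asm_perm_inj n)).
rewrite (inj_eq w_inj) eq_sym ji => /(_ isT); have := imax j kj; lia.
Qed.

Lemma card_avoids321_le_dim :
  (#|[set s : 'S_n | avoids s [:: 3; 2; 1]%N]| <= \dim {:tl F n})%N.
Proof.
set Av := [set s | _].
pose X := [tuple tlp (enum_val i) | i < #|Av|].
have /eqP dimX : free X.
  apply/freeP => k H; apply: (tl_avoids321_free (w := fun i : 'I_#|Av| => enum_val i)).
  - exact: enum_val_inj.
  - by move=> i; have := enum_valP i; rewrite inE.
  - by rewrite -[RHS]H; apply: eq_bigr => i _; rewrite -tnth_nth tnth_mktuple.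
by rewrite -(size_tuple X) -dimX dimvS ?subvf.
Qed.

End SetFunctional.
End TemperleyLiebRelations.
(** * 321-avoiding representatives *)

Section Reduction.
Variables (F : fieldType) (n : nat) (pr pc : nat -> nat -> nat).
Hypothesis cf : catalan_family n pr pc.
Implicit Types (s t w : 'S_n).
Local Notation tlp := (@tl_perm F n).
Local Notation cideal s := (cideal (n := n) pr pc (asm_perm s)).

(** Filtration by the size of the ideal. Strictly lower classes have strictly larger ideals, hence
    the name refers to sizes. *)
Definition tl_above (k : nat) : {vspace tl F n} :=
  <<[seq tlp w | w in [set w : 'S_n | (k < #|cideal w|)%N]]>>%VS.

Lemma mem_tl_above k w : (k < #|cideal w|)%N -> tlp w \in tl_above k.
Proof. by move=> kw; rewrite memv_span // image_f // inE. Qed.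

Lemma mem_tl_above_le k t w : (k < #|cideal t|)%N -> (asm_perm w <= asm_perm t)%O ->
  tlp w \in tl_above k.
Proof.
by move=> kt /(cideal_mono cf)/subset_leq_card/(leq_trans kt); apply: mem_tl_above.
Qed.

(* Exactly one of the two boxes of the chosen occurrence of 321 contains an
   active point: undoing the inversion of the other box stays in the class,
   while all other terms of the relation lie in strictly lower classes. *)
Lemma contains321_reduce s : contains_pattern s [:: 3; 2; 1]%N ->
  exists t, [/\ (asm_perm t <= asm_perm s)%O, t != s, cideal t = cideal s &
    tlp s - tlp t \in tl_above #|cideal s|].
Proof.
move=> /(inversion_active cf)[x [y [z [xy yz yx zy [a [b [act box]]]]]]].
have xz := ltn_trans xy yz; have zx := ltn_trans zy yx.
have [nxy nyz nxz] : [/\ x != y, y != z & x != z].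
  by split; rewrite -val_eqE /=; lia.
have tperm_neq u v : u != v -> (tperm u v * s)%g != s.
  move=> uv; apply: contra_neq uv => e; apply: (@perm_inj _ s).
  by rewrite -[in RHS]e permM tpermR.
have le123 : (asm_perm (tperm x z * s)%g <= asm_perm (tperm x y * tperm x z * s)%g)%O.
  have -> : (tperm x z * s = tperm x y * (tperm x y * tperm x z * s))%g.
    by rewrite !mulgA tperm2 mul1g.
  by apply: tperm_le => //; rewrite !permM tpermL tpermR tpermL tpermD // eq_sym.
case: box => box.
- have lt1 := cideal_tperm_lt cf xy yx act box.
  have le132 : (asm_perm (tperm x z * tperm x y * s)%g <= asm_perm (tperm x y * s)%g)%O.
    by rewrite -mulgA; apply: tperm_le; rewrite // !permM tpermL tpermD.
  have le213 : (asm_perm (tperm x y * tperm x z * s)%g <= asm_perm (tperm x y * s)%g)%O.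
    rewrite (_ : tperm x y * tperm x z = tperm y z * tperm x y)%g.
      by rewrite -mulgA; apply: tperm_le; rewrite // !permM tpermR tpermD.
    by rewrite [RHS]conjgC tpermJ tpermR tpermD.
  exists (tperm y z * s)%g; split; [exact: tperm_le|exact: tperm_neq| |].
    (* The boxes meet at the dot of [y], so active points in both would contradict [cf_no_cross]
       with [y] in both roles. *)
    apply: (cideal_tperm_eq yz zy) => a' b' [T' E'].
    case/andP=> box'1 box'2; case: act => T E.
    by apply: (@cf_no_cross n pr pc cf s a b a' b' y y); rewrite ?E ?E' //; lia.
  rewrite (tl_perm_relation F s xy yz).
  rewrite [X in X - _](_ : _ = tlp (tperm y z * s)%g + (tlp (tperm x y * s)%g +
      tlp (tperm x z * s)%g - tlp (tperm x y * tperm x z * s)%g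
      - tlp (tperm x z * tperm x y * s)%g)); last first.
    by rewrite -!addrA [LHS]addrCA.
  rewrite addrAC subrr add0r !(memvB, memvD) ?(mem_tl_above lt1) //;
    apply: (mem_tl_above_le lt1) => //.
  exact: le_trans le213.
- have lt2 := cideal_tperm_lt cf yz zy act box.
  have le132 : (asm_perm (tperm x z * tperm x y * s)%g <= asm_perm (tperm y z * s)%g)%O.
    rewrite (_ : tperm x z * tperm x y = tperm x y * tperm y z)%g.
      by rewrite -mulgA; apply: tperm_le; rewrite // !permM tpermL !tpermD 1?eq_sym // tpermL.
    by rewrite conjgC tpermJ tpermL tpermD ?(eq_sym z).
  have le213 : (asm_perm (tperm x y * tperm x z * s)%g <= asm_perm (tperm y z * s)%g)%O.
    rewrite (_ : tperm x y * tperm x z = tperm x z * tperm y z)%g.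
      by rewrite -mulgA; apply: tperm_le; rewrite // !permM tpermR !tpermD 1?eq_sym // tpermR.
    by rewrite conjgC tpermJ tpermL tpermD ?(eq_sym z) // (tpermC z).
  exists (tperm x y * s)%g; split; [exact: tperm_le|exact: tperm_neq| |].
    apply: (cideal_tperm_eq xy yx) => a' b' [T' E'].
    case/andP=> box'1 box'2; case: act => T E.
    by apply: (@cf_no_cross n pr pc cf s a' b' a b y y); rewrite ?E ?E' //; lia.
  rewrite (tl_perm_relation F s xy yz).
  rewrite [X in X - _](_ : _ = tlp (tperm x y * s)%g + (tlp (tperm y z * s)%g +
      tlp (tperm x z * s)%g - tlp (tperm x y * tperm x z * s)%g
      - tlp (tperm x z * tperm x y * s)%g)); last first.
    by rewrite -!addrA.
  rewrite addrAC subrr add0r !(memvB, memvD) ?(mem_tl_above lt2) //;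
    apply: (mem_tl_above_le lt2) => //.
  exact: le_trans le213.
Qed.

Lemma avoids321_below s : exists t, [/\ avoids t [:: 3; 2; 1]%N,
  (asm_perm t <= asm_perm s)%O, cideal t = cideal s &
  tlp s - tlp t \in tl_above #|cideal s|].
Proof.
have [k] := ubnP (asm_ht (asm_perm s)); elim: k => // k IHk in s *.
rewrite ltnS => sk; have [/contains321_reduce[t [ts nts ct dt]]|av] :=
    boolP (contains_pattern s [:: 3; 2; 1]%N); last first.
  by exists s; split=> //; rewrite subrr mem0v.
have [|w [aw wt cw dw]] := IHk t.
  by apply: leq_trans sk; apply: asm_ht_lt; rewrite // (inj_eq (@asm_perm_inj n)).
exists w; split=> //; [exact: le_trans ts|by rewrite cw|].
by rewrite -(subrKA (tlp t)) memvD // -ct.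
Qed.

(** The left side does not mention the family, which allows counting across families. *)
Lemma lower_ideal_avoids321 (C : {set 'I_n * 'I_n}) : lower_ideal C <->
  C \in [set cideal s | s in [set s | avoids s [:: 3; 2; 1]%N]].
Proof.
split=> [/(lower_ideal_perm cf)[s [_ <- _]]|/imsetP[s _ ->]]; last exact: cideal_lower.
have [t [av _ <- _]] := avoids321_below s.
by apply: imset_f; rewrite inE.
Qed.

End Reduction.

(** * Distinct 321-avoiding permutations lie in distinct classes *)

Section Uniqueness.
Variable n : nat.
Implicit Types (s t : 'S_n).

(** Here [(a, b)] is in the ideal iff the first [a + 1] values are all below [n - 1 - b], so the
    ideal records the prefix maxima. *)
Let pr0 (a b : nat) := a.+1.
Let pc0 (a b : nat) := (n - 1 - b)%N.

Lemma catalan_family0 : catalan_family n pr0 pc0.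
Proof. by split=> a b; rewrite /pr0 /pc0; lia. Qed.

Lemma avoids321_inj0 :
  {in [set s : 'S_n | avoids s [:: 3; 2; 1]%N] &,
    injective (fun s => cideal pr0 pc0 (asm_perm s))}.
Proof.
have key s t (i : 'I_n) : avoids t [:: 3; 2; 1]%N ->
    cideal pr0 pc0 (asm_perm s) = cideal pr0 pc0 (asm_perm t) ->
    (forall p : 'I_n, (p < i)%N -> s p = t p) -> (s i < t i)%N -> False.
  move=> /contains_pattern321P av st agree sti.
  pose k := (t^-1)%g (s i); have tk : t k = s i by rewrite permKV.
  have ik : (i < k)%N.
    rewrite ltnNge leq_eqVlt; apply/negP => /orP[/eqP/val_inj ki|ki].
      by move: sti; rewrite -tk ki ltnn.
    by have := agree k ki; rewrite tk => /perm_inj ki'; rewrite ki' ltnn in ki.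
  (* An earlier value above [t i] would form a 321 in [t] with positions [i] and [k], so [t] has a
     new prefix maximum at [i] that [s] has not reached. *)
  have sp (p : 'I_n) : (p <= i)%N -> (s p < t i)%N.
    rewrite leq_eqVlt => /orP[/eqP/val_inj->//|pi].
    rewrite ltnNge leq_eqVlt; apply/negP => /orP[/eqP/val_inj|tip].
      by rewrite agree // => /perm_inj ip; rewrite ip ltnn in pi.
    by apply: av; exists p, i, k; rewrite tk -(agree p pi).
  have tn : (t i <= n)%N := ltnW (ltn_ord (t i)).
  have c1 : i.+1%:Z <= corner (asm_perm s) i.+1 (t i).
    rewrite leNgt; apply/negP => /corner_perm_gap[|p]; first exact: ltn_ord.
    by rewrite ltnS => /sp; lia.
  have c2 : corner (asm_perm t) i.+1 (t i) < i.+1%:Z.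
    by apply: (@corner_perm_lt_row _ _ i); have := ltn_ord i; lia.
  have [_ _ _ c3] := corner_spec_bounds (asm_corner (asm_perm s)) (ltn_ord i) tn.
  have bn : (n - 1 - t i < n)%N by have := ltn_ord i; lia.
  have bE : (n - 1 - (n - 1 - t i) = t i)%N by have := ltn_ord (t i); lia.
  have /setP/(_ (i, Ordinal bn)) := st; rewrite !inE /= /pr0 /pc0 /= bE.
  have -> /= : (i + (n - 1 - t i) + 2 <= n)%N by have := ltn_ord (t i); lia.
  by move: c1 c2 => /=; lia.
move=> s t; rewrite !inE => avs avt st; apply/eqP/negPn/negP => nst.
have [j0 nj0] : exists j, s j != t j.
  apply/existsP; apply: contraNT nst => /existsPn H; apply/eqP/permP => j.
  by apply/eqP/negPn/H.
have [i ni imin] := @arg_minnP _ j0 (fun j => s j != t j) val nj0.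
have agree (p : 'I_n) : (p < i)%N -> s p = t p.
  by move=> pi; apply/eqP; apply: contraTT pi => /imin; rewrite -leqNgt.
move: ni; rewrite neq_ltn => /orP[] lt; first exact: key avt st agree lt.
by apply: (key t s i) => // p /agree.
Qed.

(* The number of lower ideals does not depend on the family, so injectivity
   carries over from one family to all. *)
Lemma avoids321_inj pr pc : catalan_family n pr pc ->
  {in [set s : 'S_n | avoids s [:: 3; 2; 1]%N] &,
    injective (fun s => cideal pr pc (asm_perm s))}.
Proof.
move=> cf; apply/imset_injP.
rewrite -(card_in_imset avoids321_inj0); apply/eqP/eq_card => C.
have H := lower_ideal_avoids321 rat cf C.
have H0 := lower_ideal_avoids321 rat catalan_family0 C.
by apply/idP/idP => [/H/H0|/H0/H].
Qed.

End Uniqueness.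
(** * Prime filters of alternating sign matrices *)

Section PrimeFilters.
Variable n : nat.
Implicit Types (A B : asm n) (chi : asm n -> bool).

(** The indicator of a prime filter, the empty and the full ones included. *)
Definition bool_hom chi : Prop := forall A B,
  chi (A `&` B)%O = chi A && chi B /\ chi (A `|` B)%O = chi A || chi B.

Lemma bool_hom_mono chi A B : bool_hom chi -> (A <= B)%O -> chi A -> chi B.
Proof. by move=> chiP /meet_idPl AB; have [+ _] := chiP A B; rewrite AB => -> /andP[]. Qed.

(* The corner sums of the least matrix whose corner sum at [(i, j)] is at most
   [r]; the inner maximum makes it a matrix also when there is none. *)
Definition point_corner (i j : 'I_n.+1) (r : int) (i' j' : nat) : int :=
  Num.min (Num.min i'%:Z j'%:Z)
    (Num.max r (Num.max 0 ((i + j)%:Z - n%:Z)) + (i' - i)%N%:Z + (j' - j)%N%:Z).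

Lemma point_corner_spec (i j : 'I_n.+1) r : corner_spec n (point_corner i j r).
Proof.
by have := ltn_ord i; have := ltn_ord j; split=> *; rewrite /zero_one /point_corner; lia.
Qed.

Definition asm_point i j r : asm n := Asm (of_corner_asm (point_corner_spec i j r)).

Lemma asm_pointE (i j : 'I_n.+1) r i' j' : (i' <= n)%N -> (j' <= n)%N ->
  corner (asm_point i j r) i' j' = point_corner i j r i' j'.
Proof. by move=> *; apply: corner_of_corner => //; apply: point_corner_spec. Qed.

Lemma asm_point_le (i j : 'I_n.+1) r A : corner A i j <= r -> (asm_point i j r <= A)%O.
Proof.
move=> Ar; apply/asm_leP => i' j' il jl; rewrite asm_pointE // /point_corner.
have [ni nj] : (i <= n)%N /\ (j <= n)%N by have := ltn_ord i; have := ltn_ord j; lia.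
have fP := asm_corner A; have [b1 b2 b3 b4] := corner_spec_bounds fP il jl.
set x := maxn i i'; set y := maxn j j'.
have L1 : (i <= x <= n)%N by rewrite /x; lia.
have L2 : (j <= y <= n)%N by rewrite /y; lia.
have L3 : (i' <= x <= n)%N by rewrite /x; lia.
have L4 : (j' <= y <= n)%N by rewrite /y; lia.
have xn : (x <= n)%N by rewrite /x; lia.
have := corner_spec_lipl fP L1 nj; have := corner_spec_lipr fP xn L2.
have := corner_spec_lipl fP L3 jl; have := corner_spec_lipr fP xn L4.
rewrite /x /y; lia.
Qed.

(** [A] lies below the join of its points, and a prime filter containing a finite join contains one
    of its terms. *)
Lemma bool_hom_point chi A : bool_hom chi -> chi A ->
  exists i j : 'I_n.+1, chi (asm_point i j (corner A i j)).
Proof.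
move=> chiP cA; pose P (x : 'I_n.+1 * 'I_n.+1) := asm_point x.1 x.2 (corner A x.1 x.2).
pose B l := foldr Order.join (P (ord0, ord0)) [seq P x | x <- l].
have Bc l x : x \in l -> (P x <= B l)%O.
  elim: l => //= y l IHl; rewrite inE => /orP[/eqP ->|/IHl]; first exact: leUl.
  by move/le_trans; apply; apply: leUr.
have cB l : chi (B l) -> exists x, chi (P x).
  elim: l => [|y l IHl] /=; first by exists (ord0, ord0).
  by have [_ ->] := chiP (P y) (B l) => /orP[cy|/IHl//]; exists y.
have AB : (A <= B (enum {: 'I_n.+1 * 'I_n.+1}))%O.
  apply/asm_leP => i j il jl.
  have := Bc (enum {: 'I_n.+1 * 'I_n.+1}) (inord i, inord j).
  rewrite mem_enum => /(_ isT)/asm_le_corner/(_ i j il jl).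
  rewrite asm_pointE // /point_corner /= !inordK ?ltnS //.
  have [b1 b2 b3 b4] := corner_spec_bounds (asm_corner A) il jl; lia.
have [[i j] cP] := cB _ (bool_hom_mono chiP AB cA).
by exists i, j.
Qed.

Lemma bool_hom_threshold chi : bool_hom chi -> (exists A, chi A) ->
  exists i j r : nat, [/\ (i <= n)%N, (j <= n)%N & forall A, chi A = (corner A i j <= r%:Z)].
Proof.
move=> chiP [A0 cA0].
have [[i j] ijP] : exists x : 'I_n.+1 * 'I_n.+1,
    forall A, chi A -> chi (asm_point x.1 x.2 (corner A x.1 x.2)).
  (* If each [(i, j)] had a counterexample, their meet would be in the filter, hence one of its
     points; that point lies below the corresponding point of the counterexample. *)
  apply: contrapT => /forallNP N.
  have {}N x : exists A, chi A && ~~ chi (asm_point x.1 x.2 (corner A x.1 x.2)).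
    by have /existsNP[A /not_implyP[cA /negP ncA]] := N x; exists A; rewrite cA.
  have [g gP] := fin_all_exists N.
  pose B l := foldr Order.meet A0 [seq g x | x <- l].
  have cB l : chi (B l).
    elim: l => //= x l IHl; have [-> _] := chiP (g x) (B l).
    by have /andP[-> _] := gP x.
  have Bc l x : x \in l -> (B l <= g x)%O.
    elim: l => //= y l IHl; rewrite inE => /orP[/eqP ->|/IHl]; first exact: leIl.
    exact/le_trans/leIr.
  have [i [j cij]] := bool_hom_point chiP (cB (enum {: 'I_n.+1 * 'I_n.+1})).
  have := Bc (enum {: 'I_n.+1 * 'I_n.+1}) (i, j); rewrite mem_enum => /(_ isT) le_g.
  have [ni nj] : (i <= n)%N /\ (j <= n)%N by have := ltn_ord i; have := ltn_ord j; lia.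
  have /andP[_ /negP] := gP (i, j); apply; apply: bool_hom_mono chiP _ cij.
  apply: asm_point_le; rewrite asm_pointE //= /point_corner.
  have := asm_le_corner le_g ni nj => /=.
  have [b1 b2 b3 b4] :=
    corner_spec_bounds (asm_corner (B (enum {: 'I_n.+1 * 'I_n.+1}))) ni nj.
  lia.
rewrite /= in ijP.
have [ni nj] : (i <= n)%N /\ (j <= n)%N by have := ltn_ord i; have := ltn_ord j; lia.
have cA A : chi A = chi (asm_point i j (corner A i j)).
  apply/idP/idP => [/ijP//|]; apply: bool_hom_mono => //; exact: asm_point_le.
pose P k := (k <= n)%N && chi (asm_point i j k%:Z).
have cornerN A : exists2 k : nat, (k <= n)%N & corner A i j = k%:Z.
  have [b1 _ b2 _] := corner_spec_bounds (asm_corner A) ni nj.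
  by exists `|corner A i j|%N; lia.
have exP : exists k, P k.
  by have [k kn e] := cornerN A0; exists k; rewrite /P kn -e -cA.
have ubP k : P k -> (k <= n)%N by case/andP.
case: (ex_maxnP exP ubP) => r /andP[rn cr] rmax.
exists i, j, r; split=> // A; have [k kn e] := cornerN A; rewrite e lez_nat.
apply/idP/idP => [|kr]; first by rewrite cA e => ck; apply: rmax; rewrite /P kn.
by apply: bool_hom_mono cr => //; apply: asm_point_le; rewrite e lez_nat.
Qed.

End PrimeFilters.

(** * The possible families of corner conditions *)

Section PointFamily.
Variable n : nat.

(** The bounds make each condition neither always true nor always false. The steps, with truncated
    differences, express implication between neighbouring conditions. *)
Record point_family (pr pc r : nat -> nat -> nat) : Prop := PointFamily {
  pf_bounds : forall a b, (a + b + 2 <= n)%N -> [/\ (r a b < pr a b)%N,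
    (r a b < pc a b)%N, (pr a b + pc a b <= r a b + n)%N, (pr a b <= n)%N
    & (pc a b <= n)%N];
  pf_stepl : forall a b, (a.+1 + b + 2 <= n)%N ->
    (r a b + (pr a.+1 b - pr a b) + (pc a.+1 b - pc a b) <= r a.+1 b)%N;
  pf_stepr : forall a b, (a + b.+1 + 2 <= n)%N ->
    (r a b + (pr a b.+1 - pr a b) + (pc a b.+1 - pc a b) <= r a b.+1)%N;
  pf_inj : forall a b a' b', (a + b + 2 <= n)%N -> (a' + b' + 2 <= n)%N ->
    pr a b = pr a' b' -> pc a b = pc a' b' -> r a b = r a' b' -> a = a' /\ b = b'
}.

(** A unit-step walk that never undoes a step keeps its direction, and the range leaves room for
    just one start. *)
Lemma unit_steps_monotone (d : nat -> nat) N :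
    (forall t, (t <= N)%N -> (0 < d t <= N.+1)%N) ->
    (forall t, (t < N)%N -> d t.+1 = (d t).+1 \/ d t = (d t.+1).+1) ->
    (forall t, (t.+1 < N)%N -> d t <> d t.+2) ->
  (forall t, (t <= N)%N -> d t = t.+1) \/ (forall t, (t <= N)%N -> (d t + t = N.+1)%N).
Proof.
move=> bd st inj.
have [up|dn] : (forall t, (t <= N)%N -> d t = (d 0 + t)%N) \/
               (forall t, (t <= N)%N -> (d t + t = d 0)%N); last 2 first.
- left=> t tN; have := up t tN; have := up N (leqnn N).
  by have := bd 0%N (leq0n N); have := bd N (leqnn N); lia.
- right=> t tN; have := dn t tN; have := dn N (leqnn N).
  by have := bd 0%N (leq0n N); have := bd N (leqnn N); lia.
case: N {bd} st inj => [|N] st inj.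
  by left=> t; rewrite leqn0 => /eqP ->; rewrite addn0.
have [d1|d1] := st 0%N isT; [left|right].
- have H t : (t <= N)%N -> d t = (d 0 + t)%N /\ d t.+1 = (d 0 + t.+1)%N.
    elim: t => [_|t IHt tN]; first by lia.
    have [e1 e2] := IHt (ltnW tN); split=> //.
    by have := st t.+1 tN; have := inj t tN; lia.
  by case=> [|t]; [rewrite addn0|rewrite ltnS => /H[]].
- have H t : (t <= N)%N -> (d t + t = d 0)%N /\ (d t.+1 + t.+1 = d 0)%N.
    elim: t => [_|t IHt tN]; first by lia.
    have [e1 e2] := IHt (ltnW tN); split=> //.
    by have := st t.+1 tN; have := inj t tN; lia.
  by case=> [|t]; [rewrite addn0|rewrite ltnS => /H[]].
Qed.

Section Levels.
Variables pr pc r : nat -> nat -> nat.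
Hypothesis pf : point_family pr pc r.

(** The step inequality gives the weak form, and equality would make the two conditions coincide. *)
Lemma pf_strictl a b : (a.+1 + b + 2 <= n)%N ->
  (pr a.+1 b + pc a.+1 b + 2 * r a b < pr a b + pc a b + 2 * r a.+1 b)%N.
Proof.
move=> T'; have T : (a + b + 2 <= n)%N by lia.
by have := pf_stepl pf T'; have := pf_inj pf T T'; lia.
Qed.

Lemma pf_strictr a b : (a + b.+1 + 2 <= n)%N ->
  (pr a b.+1 + pc a b.+1 + 2 * r a b < pr a b + pc a b + 2 * r a b.+1)%N.
Proof.
move=> T'; have T : (a + b + 2 <= n)%N by lia.
by have := pf_stepr pf T'; have := pf_inj pf T T'; lia.
Qed.

(* The height [pr + pc - 2 r] of the points strictly decreases along the steps
   and lies between 2 and [n], which leaves no slack. *)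
Lemma pf_height a b : (a + b + 2 <= n)%N -> (pr a b + pc a b + a + b = n + 2 * r a b)%N.
Proof.
move=> T; apply/eqP; rewrite eqn_leq; apply/andP; split.
  elim: a b T => [|a IHa] b T; last first.
    have T' : (a + b + 2 <= n)%N by lia.
    by have := IHa b T'; have := pf_strictl T; lia.
  elim: b T => [|b IHb] T; first by have [*] := pf_bounds pf T; lia.
  have T' : (0 + b + 2 <= n)%N by lia.
  by have := IHb T'; have := pf_strictr T; lia.
have [k] := ubnP (n - a - b); elim: k a T => // k IHk a T ak.
have [T'|T'] := leqP (a.+1 + b + 2) n; last by have [*] := pf_bounds pf T; lia.
have := IHk a.+1 T'; have := pf_strictl T'; lia.
Qed.

Lemma pf_diagE a b : (a + b + 2 = n)%N -> pc a b = pr a b /\ (r a b).+1 = pr a b.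
Proof.
move=> e; have T := eq_leq e; have := pf_height T; have [*] := pf_bounds pf T; lia.
Qed.

(** Boundary points have height 2 and are diagonal. Two consecutive ones share a neighbour of height
    3, so they differ by one unit, and injectivity forbids turning back. *)
Lemma pf_diag : (2 <= n)%N ->
  (forall a b, (a + b + 2 = n)%N -> pr a b = a.+1) \/
  (forall a b, (a + b + 2 = n)%N -> pr a b = b.+1).
Proof.
move=> n2; have Tt t : (t <= n - 2)%N -> (t + (n - 2 - t) + 2 = n)%N by lia.
have [|||up|dn] := @unit_steps_monotone (fun t => pr t (n - 2 - t)%N) (n - 2).
- move=> t /Tt T; have [*] := pf_bounds pf (eq_leq T).
  by have := pf_diagE T; lia.
- move=> t tn; have tn' := ltnW tn.
  have e : (n - 2 - t = (n - 2 - t.+1).+1)%N by lia.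
  have T1 := Tt _ tn; have T2 := Tt _ tn'; rewrite e in T2 *.
  have T3 : (t + (n - 2 - t.+1) + 2 <= n)%N by lia.
  have := pf_stepl pf (eq_leq T1); have := pf_stepr pf (eq_leq T2).
  have := pf_diagE T1; have := pf_diagE T2; have := pf_height T3.
  have := pf_inj pf (eq_leq T1) (eq_leq T2); have [*] := pf_bounds pf T3; lia.
- move=> t tn e; have T1 := Tt t ltac:(lia); have T2 := Tt t.+2 tn.
  have := pf_inj pf (eq_leq T1) (eq_leq T2); have := pf_diagE T1; have := pf_diagE T2; lia.
- left=> a b e; have an : (a <= n - 2)%N by lia.
  by have := up a an; rewrite (_ : n - 2 - a = b)%N //; lia.
- right=> a b e; have an : (a <= n - 2)%N by lia.
  by have := dn a an; rewrite (_ : n - 2 - a = b)%N; lia.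
Qed.

(** Induction inwards from the boundary. A step lowers the height by exactly one, so [r] rises by 0
    or 1; the neighbours' levels [a + 1] and [a] then leave only [r a b = a]. *)
Lemma pf_catalan : (forall a b, (a + b + 2 = n)%N -> pr a b = a.+1) ->
  catalan_family n pr pc /\ forall a b, (a + b + 2 <= n)%N -> r a b = a.
Proof.
move=> dg; have ra a b : (a + b + 2 <= n)%N -> r a b = a.
  move=> T; have [k] := ubnP (n - a - b); elim: k a b T => // k IHk a b T ak.
  have [T1|T1] := leqP (a.+1 + b + 2) n; last first.
    have e : (a + b + 2 = n)%N by lia.
    by have := dg a b e; have := pf_diagE e; lia.
  have T2 : (a + b.+1 + 2 <= n)%N by lia.
  have := IHk a.+1 b T1 ltac:(lia); have := IHk a b.+1 T2 ltac:(lia).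
  have := pf_stepl pf T1; have := pf_stepr pf T2.
  have := pf_height T; have := pf_height T1; lia.
split=> //; split=> a b T.
- by have := pf_height T; rewrite ra //; lia.
- have T' : (a + b + 2 <= n)%N by lia.
  have := pf_stepl pf T; have := pf_height T; have := pf_height T'.
  by rewrite !ra //; lia.
- have T' : (a + b + 2 <= n)%N by lia.
  have := pf_stepr pf T; have := pf_height T; have := pf_height T'.
  by rewrite !ra //; lia.
- by have := dg a b T; have := pf_diagE T; lia.
Qed.

End Levels.

Lemma pf_swap pr pc r : point_family pr pc r ->
  point_family (fun a b => pr b a) (fun a b => pc b a) (fun a b => r b a).
Proof.
have TC a b : (a + b + 2 <= n)%N -> (b + a + 2 <= n)%N by rewrite (addnC a).
case=> H1 H2 H3 H4; split=> [a b /TC/H1//|a b|a b|a b a' b' /TC T /TC T' e1 e2 e3].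
- by move=> T; apply: H3; lia.
- by move=> T; apply: H2; lia.
- by have [] := H4 _ _ _ _ T T' e1 e2 e3.
Qed.
End PointFamily.
(** * The structure of catalan congruences *)

Section CatalanStructure.
Variable n : nat.
Implicit Types (A B : asm n) (p q : dyck n).

(* The hypotheses are met by the filters of Dyck paths of height at least
   [n - a - b] at abscissa [n + a - b], and are symmetric in [a] and [b]. *)
Lemma point_family_of (chi : nat -> nat -> asm n -> bool) :
    (forall a b, (a + b + 2 <= n)%N -> bool_hom (chi a b)) ->
    (forall a b, (a + b + 2 <= n)%N -> exists A, forall a' b', (a' + b' + 2 <= n)%N ->
       chi a' b' A = (a <= a')%N && (b <= b')%N) ->
    (forall a b A, (a.+1 + b + 2 <= n)%N -> chi a b A -> chi a.+1 b A) ->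
    (forall a b A, (a + b.+1 + 2 <= n)%N -> chi a b A -> chi a b.+1 A) ->
    (exists A, forall a b, (a + b + 2 <= n)%N -> chi a b A = false) ->
  exists pr pc r, point_family n pr pc r /\
    forall a b A, (a + b + 2 <= n)%N -> chi a b A = (corner A (pr a b) (pc a b) <= (r a b)%:Z).
Proof.
move=> chi_hom chi_peak chi_l chi_r [A0 chi0].
have ex (x : nat * nat) : exists y : nat * nat * nat, (x.1 + x.2 + 2 <= n)%N ->
    [/\ (y.1.1 <= n)%N, (y.1.2 <= n)%N &
        forall A, chi x.1 x.2 A = (corner A y.1.1 y.1.2 <= y.2%:Z)].
  (* Outside the triangle any value will do. *)
  have [T|] := leqP (x.1 + x.2 + 2) n; last by exists (0, 0, 0)%N.
  have [|i [j [r [il jl H]]]] := bool_hom_threshold (chi_hom _ _ T).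
    have [A AP] := chi_peak _ _ T.
    by exists A; rewrite AP ?leqnn.
  by exists (i, j, r).
have [g gP] := choice ex.
pose pr a b := (g (a, b)).1.1; pose pc a b := (g (a, b)).1.2; pose r a b := (g (a, b)).2.
have chiE a b : (a + b + 2 <= n)%N -> [/\ (pr a b <= n)%N, (pc a b <= n)%N &
    forall A, chi a b A = (corner A (pr a b) (pc a b) <= (r a b)%:Z)].
  exact: (gP (a, b)).
have bnd a b : (a + b + 2 <= n)%N -> [/\ (r a b < pr a b)%N, (r a b < pc a b)%N,
    (pr a b + pc a b <= r a b + n)%N, (pr a b <= n)%N & (pc a b <= n)%N].
  move=> T; have [il jl E] := chiE a b T; have [A AP] := chi_peak a b T.
  have := E A; rewrite AP // !leqnn /= => /esym cA.
  have := E A0; rewrite chi0 // => /esym/negbT; rewrite -ltNge => cA0.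
  have [_ b1 _ _] := corner_spec_bounds (asm_corner A) il jl.
  have [_ _ b3 b4] := corner_spec_bounds (asm_corner A0) il jl.
  split; lia.
have imp a b a' b' : (a + b + 2 <= n)%N -> (a' + b' + 2 <= n)%N ->
    (forall A, chi a b A -> chi a' b' A) ->
    (r a b + (pr a' b' - pr a b) + (pc a' b' - pc a b) <= r a' b')%N.
  move=> T T' H; have [il jl E] := chiE a b T; have [il' jl' E'] := chiE a' b' T'.
  have [b1 b2 b3 _ _] := bnd a b T; have [b1' b2' b3' _ _] := bnd a' b' T'.
  (* The implication is tested on the least matrix satisfying its premise. *)
  have := H (asm_point (inord (pr a b)) (inord (pc a b)) (r a b)%:Z).
  rewrite E E' !asm_pointE // /point_corner !inordK ?ltnS //.
  lia.
exists pr, pc, r; split; last by move=> a b A /chiE[].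
split=> // [a b T|a b T|a b a' b' T T' e1 e2 e3].
- by apply: imp => // [|A]; [lia|apply: chi_l].
- by apply: imp => // [|A]; [lia|apply: chi_r].
have [_ _ E] := chiE a b T; have [_ _ E'] := chiE a' b' T'.
have chi_eq A : chi a b A = chi a' b' A by rewrite E E' e1 e2 e3.
have [A AP] := chi_peak a b T; have [A' AP'] := chi_peak a' b' T'.
have := chi_eq A; have := chi_eq A'; rewrite !AP // !AP' // !leqnn /=.
lia.
Qed.

Lemma dyck_spec_le f k : dyck_spec n f -> (k <= 2 * n)%N ->
  f k <= k%:Z /\ f k <= (2 * n)%:Z - k%:Z.
Proof.
case=> f0 f1 _ fS kn; split.
  elim: k kn => [|k IHk] kn; first by rewrite f0.
  by have := IHk (ltnW kn); have := fS k kn; lia.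
have H m : (m <= 2 * n)%N -> f (2 * n - m)%N <= m%:Z.
  elim: m => [|m IHm] mn; first by rewrite subn0 f1.
  have := IHm (ltnW mn); have := fS (2 * n - m.+1)%N ltac:(lia).
  by rewrite (_ : (2 * n - m.+1).+1 = 2 * n - m)%N; lia.
by have := H (2 * n - k)%N (leq_subr _ _); rewrite subKn //; lia.
Qed.

(** The least Dyck path through height [n - a - b] at abscissa [n + a - b]; [odd m] is the height of
    the lowest path. *)
Definition dyck_peak_height (a b m : nat) : int :=
  Num.max (odd m)%:Z (n%:Z - a%:Z - b%:Z - `|m%:Z - (n%:Z + a%:Z - b%:Z)|).

Lemma dyck_peak_spec a b : (a + b <= n)%N -> dyck_spec n (dyck_peak_height a b).
Proof. by move=> ab; split=> *; rewrite /dyck_peak_height; lia. Qed.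

(** The range [a + b + 2 <= n] means heights at least 2: by parity, every path satisfies the
    conditions of height 0 or 1. *)
Definition dyck_above (a b : nat) p : bool :=
  (n - a - b)%N%:Z <= height p (n + a - b).

Lemma dyck_peak_exists a b : (a + b <= n)%N -> exists p, forall a' b',
  (a' + b' + 2 <= n)%N -> dyck_above a' b' p = (a <= a')%N && (b <= b')%N.
Proof.
move=> ab; exists (Dyck (of_height_dyck (dyck_peak_spec ab))) => a' b' T.
rewrite /dyck_above height_of_height; last by lia.
  by rewrite /dyck_peak_height; lia.
exact: dyck_peak_spec.
Qed.

Lemma dyck_above_eq p q :
  (forall a b, (a + b + 2 <= n)%N -> dyck_above a b p = dyck_above a b q) -> p = q.
Proof.
have key p' q' : (forall a b, (a + b + 2 <= n)%N -> dyck_above a b p' = dyck_above a b q') ->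
    (p' <= q')%O.
  move=> H; apply/dyck_leP => k kn; rewrite leNgt; apply/negP => lt.
  have [q0 _ q2 _] := height_dyck q'; have := q2 k kn => {}q2.
  have [x ex] := dyck_spec_parity (height_dyck p') kn.
  have [y ey] := dyck_spec_parity (height_dyck q') kn.
  have [l1 l2] := dyck_spec_le (height_dyck p') kn.
  (* [a] counts the down steps of [p'] before [k] and [b] its up steps after [k], so [p'] has height
     [n - a - b] at [k = n + a - b]. *)
  have [a ea] : exists a : nat, a%:Z = - x by exists `|x|%N; lia.
  have [b eb] : exists b : nat, (b + k = n + a)%N by exists (n + a - k)%N; lia.
  have := H a b ltac:(lia); rewrite /dyck_above (_ : n + a - b = k)%N; lia.
by move=> H; apply/le_anti/andP; split; apply: key => // a b T; rewrite H.
Qed.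

Lemma catalan_familyP (c : congruence (asm n)) : catalan c ->
  exists pr pc, catalan_family n pr pc /\
    forall A B, c A B <-> cideal pr pc A = cideal pr pc B.
Proof.
case=> f [g fK gK]; pose phi A := f (class_of c A).
have phiI A B : phi (A `&` B)%O = (phi A `&` phi B)%O.
  by rewrite /phi -omorphI; congr (f _); rewrite -quot_meetE.
have phiU A B : phi (A `|` B)%O = (phi A `|` phi B)%O.
  by rewrite /phi -omorphU; congr (f _); rewrite -quot_joinE.
have phi_surj p : exists A, phi A = p.
  by exists (generic_quotient.repr (g p)); rewrite /phi class_of_repr gK.
have cE A B : c A B <-> phi A = phi B.
  split=> [/class_ofP e|/(can_inj fK)/class_ofP//]; first by rewrite /phi e.
have chi_hom a b : (a + b + 2 <= n)%N -> bool_hom (fun A => dyck_above a b (phi A)).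
  move=> T A B; rewrite phiI phiU /dyck_above dyck_meet_height ?dyck_join_height; lia.
have [|||||pr [pc [r [pf chiE]]]] := @point_family_of (fun a b A => dyck_above a b (phi A)).
- exact: chi_hom.
- move=> a b T; have [p pP] := @dyck_peak_exists a b ltac:(lia).
  by have [A e] := phi_surj p; exists A; rewrite e.
- move=> a b A T; rewrite /dyck_above; have := height_dyck (phi A).
  case=> _ _ _ /(_ (n + a - b)%N ltac:(lia)).
  rewrite (_ : (n + a - b).+1 = n + a.+1 - b)%N; lia.
- move=> a b A T; rewrite /dyck_above; have := height_dyck (phi A).
  case=> _ _ _ /(_ (n + a - b.+1)%N ltac:(lia)).
  rewrite (_ : (n + a - b.+1).+1 = n + a - b)%N; lia.
- have [p pP] := @dyck_peak_exists n 0 ltac:(lia); have [A e] := phi_surj p.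
  exists A => a b T; rewrite e pP; lia.
have conclude pr' pc' (chi : nat -> nat -> asm n -> bool) : catalan_family n pr' pc' ->
    (forall a b A, (a + b + 2 <= n)%N -> chi a b A = (corner A (pr' a b) (pc' a b) <= a%:Z)) ->
    (forall A B, phi A = phi B <->
       forall a b, (a + b + 2 <= n)%N -> chi a b A = chi a b B) ->
    exists pr pc, catalan_family n pr pc /\
      forall A B, c A B <-> cideal pr pc A = cideal pr pc B.
  move=> cf E H; exists pr', pc'; split=> // A B.
  apply: (iff_trans (cE A B)); apply: (iff_trans (H A B)); split=> [AB|/setP AB a b T].
    apply/setP => -[a b]; rewrite !inE /=; case T: (_ <= n)%N => //=.
    by rewrite !ltNge -!E // AB.
  have [an bn] : (a < n)%N /\ (b < n)%N by lia.
  have := AB (Ordinal an, Ordinal bn); rewrite !inE /= T /= !ltNge -!E //.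
  by move/negb_inj.
have phi_eq A B : phi A = phi B <-> forall a b, (a + b + 2 <= n)%N ->
    dyck_above a b (phi A) = dyck_above a b (phi B).
  by split=> [->//|]; apply: dyck_above_eq.
have [n2|n2] := leqP 2 n; last first.
  (* No index exists for [n < 2], so any family works. *)
  exists (fun=> id), (fun=> id); split=> [|A B]; first by split=> a b; lia.
  split=> [_|_]; last by apply/cE/phi_eq => a b; lia.
  by apply/setP => -[a b]; rewrite !inE /=; lia.
have [dg|dg] := pf_diag pf n2.
  have [cf ra] := pf_catalan pf dg.
  by apply: (conclude _ _ _ cf _ phi_eq) => a b A T; rewrite chiE // ra.
have [a b e|cf ra] := pf_catalan (pf_swap pf); first by rewrite dg //; lia.
(* Exchanging [a] and [b] amounts to reflecting the Dyck paths. *)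
apply: (conclude _ _ (fun a b A => dyck_above b a (phi A)) cf) => [a b A T|A B].
  by rewrite chiE ?ra // addnC (addnC b); lia.
by apply: (iff_trans (phi_eq A B)); split=> H a b T; apply: H; lia.
Qed.

End CatalanStructure.
(** * Conclusion *)

Lemma representatives_basis (F : fieldType) n pr pc (cf : catalan_family n pr pc)
    (S : {set 'S_n}) :
    (forall w : 'S_n, exists2 s, s \in S &
       cideal pr pc (asm_perm s) = cideal pr pc (asm_perm w)) ->
    {in S &, injective (fun s => cideal pr pc (asm_perm s))} ->
  basis_of (fullv : {vspace tl F n}) [seq tl_perm F s | s in S].
Proof.
move=> Srep Sinj; rewrite basisEdim size_image; apply/andP; split.
  rewrite (@tl_span_perms F n <<[seq tl_perm F s | s in S]>>) // => w.
  (* Induction from the largest ideals down. Modulo larger ideals, [w] and its representative [s]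
     both equal the 321-avoiding permutation of their class. *)
  have [k] := ubnP (#|{: 'I_n * 'I_n}| - #|cideal pr pc (asm_perm w)|)%N.
  elim: k w => // k IHk w wk.
  have above s : cideal pr pc (asm_perm s) = cideal pr pc (asm_perm w) ->
      (@tl_above F n pr pc #|cideal pr pc (asm_perm s)| <= <<[seq tl_perm F t | t in S]>>)%VS.
    move=> sw; apply/span_subvP => v /imageP[t]; rewrite inE => lt ->; apply: IHk.
    rewrite ltnS in wk; rewrite sw in lt; apply: leq_trans wk; apply: (ltn_sub2l _ lt).
    exact: leq_trans lt (max_card _).
  have [s sS sw] := Srep w.
  have [m [am _ mw dm]] := avoids321_below F cf w.
  have [m' [am' _ ms dm']] := avoids321_below F cf s.
  have mm' : m = m' by apply: (avoids321_inj cf); rewrite ?inE // mw ms sw.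
  rewrite -(subrK (tl_perm F m) (tl_perm F w)) memvD //.
    exact: (subvP (above w erefl)).
  rewrite -(subrKC (tl_perm F s) (tl_perm F m)) memvD //.
    by rewrite memv_span // image_f.
  by rewrite -opprB memvN mm' (subvP (above s sw)).
(* [S] injects into the lower ideals, which are as many as the 321-avoiding permutations. *)
apply: leq_trans (card_avoids321_le_dim F n).
rewrite -(card_in_imset Sinj) -(card_in_imset (avoids321_inj cf)).
apply/subset_leq_card/subsetP => _ /imsetP[s _ ->].
exact/(lower_ideal_avoids321 F cf)/cideal_lower.
Qed.

Theorem theorem1p2 (R : realType) (n : nat) (n_gt0 : (0 < n)%N)
    (c : congruence (asm n)) (c_catalan : catalan c) :
  [/\ (forall X : congr_quot c, exists s : 'S_n,
         [/\ covexillary s, class_of c (asm_perm s) = X &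
             forall A : asm n, class_of c A = X -> (A <= asm_perm s)%O]),
      (forall s : 'S_n,
         (forall t : 'S_n, c (asm_perm s) (asm_perm t) ->
            (asm_perm t <= asm_perm s)%O -> t = s)
         <-> avoids s [:: 3; 2; 1]%N) &
      (forall S : {set 'S_n},
         (forall X : congr_quot c,
            exists! s : 'S_n, s \in S /\ class_of c (asm_perm s) = X) ->
         basis_of (fullv : {vspace tl (complex R) n})
           [seq tl_perm (complex R) s | s in S])].
Proof.
have [pr [pc [cf cE]]] := catalan_familyP c_catalan.
have classE A B : class_of c A = class_of c B <-> cideal pr pc A = cideal pr pc B.
  by rewrite -cE; split=> /class_ofP.
split=> [X|s|S SP].
- pose A := generic_quotient.repr X.
  have [s [cov sA sM]] := lower_ideal_perm cf (cideal_lower cf A).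
  exists s; rewrite -[X]class_of_repr -/A; split=> // [|B /classE BA].
    exact/classE.
  by apply: sM; rewrite BA.
- split=> [min|av t /cE st ts].
    apply/negP => /(contains321_reduce (complex R) cf)[t [ts nts ct _]].
    by move/eqP: nts; apply; apply: min => //; apply/cE.
  (* The 321-avoiding permutation below [t] is [s] by uniqueness in the class, so [s] is also below
     [t]. *)
  have [m [am mt cm _]] := avoids321_below (complex R) cf t.
  have ms : m = s by apply: (avoids321_inj cf); rewrite ?inE // cm st.
  by apply/asm_perm_inj/le_anti; rewrite ts -ms mt.
- apply: (representatives_basis _ cf) => [w|s t sS tS /classE st].
    have [s [[sS /classE sw] _]] := SP (class_of c (asm_perm w)).
    by exists s.
  have [u [_ uU]] := SP (class_of c (asm_perm s)).
  by rewrite -(uU s) // -(uU t).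
Qed.
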